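(* Let $I\subset\mathbb{R}$ be an interval containing $0$, and let $a(t)\in\mathfrak{sl}_2(\mathbb{R})$, $t\in I$, be a smooth curve such that $|a(t)|:=2\sqrt{|\det a(t)|}$ is non-vanishing. Let $g(t)\in \mathrm{SL}_2(\mathbb{R})$ be the solution to $\dot g=ag$, $g(0)=\mathrm{I}$ (the identity matrix). Let $A(t)=g(t)^{-1}a(t)g(t)$, and let $\mathbf{n}:=a/|a|$, $\mathbf{N}:=A/|A|$ be the projections of $a$, $A$ (respectively) on the unit pseudo-sphere $\Sigma\subset\mathfrak{sl}_2(\mathbb{R})$, where $\Sigma=H^2$ if $\det a>0$ and $\Sigma=H^{1,1}$ if $\det a<0$. Then: (1) $g(t)$ rolls $\mathbf{N}$ without slipping along $\mathbf{n}$, i.e., $\mathrm{Ad}_{g(t)}\mathbf{N}(t)=\mathbf{n}(t)$ and $\mathrm{Ad}_{g(t)}\dot{\mathbf{N}}(t)=\dot{\mathbf{n}}(t)$ for all $t$. (2) If $|\dot{\mathbf{n}}|$ is non-vanishing, then the geodesic curvatures $K,k$ of $\mathbf{N},\mathbf{n}$ (respectively) are related by $$K=k-\frac{|a|}{|\dot{\mathbf{n}}|}.$$ (3) Let $R[\Phi(t)]$ be the (pseudo) rotation about $a(0)$ by the angle $\Phi(t)=\int_0^t|a(\tau)|\,d\tau$. Then $$\mathrm{Ad}_{g(t)}=P_{\mathbf{n}}(t)\circ R[\Phi(t)]\circ P_{\mathbf{N}}(t)^{-1},$$ where $P_{\mathbf{N}}(t)$ is parallel transport along $\mathbf{N}$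 from $\mathbf{N}(0)$ to $\mathbf{N}(t)$, extended linearly to $\mathfrak{sl}_2(\mathbb{R})$ by $\mathbf{N}(0)\mapsto\mathbf{N}(t)$, and similarly for $P_{\mathbf{n}}(t)$.
   Context: $\mathfrak{sl}_2(\mathbb{R})$ is the space of traceless real $2\times2$ matrices, with $[a,b]=ab-ba$, and $\mathrm{SL}_2(\mathbb{R})$ acts on it by $\mathrm{Ad}_g(a)=gag^{-1}$. It carries the $\mathrm{Ad}$-invariant inner product $\langle a,b\rangle=2\,\mathrm{tr}(ab)$ of signature $(+,+,-)$, for which $\langle a,a\rangle=-4\det a$; put $|a|=\sqrt{|\langle a,a\rangle|}=2\sqrt{|\det a|}$. Set $H^2=\{a:\langle a,a\rangle=-1\}$ (two-sheeted hyperboloid) and $H^{1,1}=\{a:\langle a,a\rangle=1\}$ (one-sheeted hyperboloid). A dot denotes $d/dt$. Geodesic curvature: for a curve $\gamma(t)$ in $\Sigma$ (either $H^2$ or $H^{1,1}$) with $|\dot\gamma|$ non-vanishing, let a prime denote the derivative with respect to arc length, $\gamma'=\dot\gamma/|\dot\gamma|$. Then $(\gamma,\gamma',[\gamma,\gamma'])$ is an orthonormal frame along $\gamma$, and the geodesic curvature of $\gamma$ is the coefficient of $[\gamma,\gamma']$ when $\gamma''$ is written as a linear combination of $\gamma,\gamma',[\gamma,\gamma']$. Parallel transport: a vector field $v(t)\in T_{\gamma(t)}\Sigma=\gamma(t)^\perp$ along a curve $\gamma(t)$ in $\Sigma$ is parallel if $\dot v(t)$ is a multiple of $\gamma(t)$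 for all $t$. Parallel transport along $\gamma$ is the isometry $T_{\gamma(0)}\Sigma\to T_{\gamma(t)}\Sigma$, $v(0)\mapsto v(t)$, for parallel $v$. (Pseudo) rotation: $R[\Phi]$ about $a(0)$ is the linear map of $\mathfrak{sl}_2(\mathbb{R})$ fixing $\mathbf{n}(0)=a(0)/|a(0)|$ and acting on $v\in\mathbf{n}(0)^\perp=T_{\mathbf{n}(0)}\Sigma$ by $v\mapsto(\cos\Phi)v+(\sin\Phi)[\mathbf{n}(0),v]$ if $\Sigma=H^2$, and by $v\mapsto(\cosh\Phi)v+(\sinh\Phi)[\mathbf{n}(0),v]$ if $\Sigma=H^{1,1}$. *)

(* Defs.v *)
(* MathComp-Analysis, over an arbitrary R : realType. *)
From HB Require Import structures.
From mathcomp Require Import all_boot all_order all_algebra.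
From mathcomp Require Import all_classical all_reals all_analysis.
From mathcomp Require Import ring.

Set Implicit Arguments.
Unset Strict Implicit.
Unset Printing Implicit Defensive.

Import Order.TTheory GRing.Theory Num.Theory.
Import numFieldNormedType.Exports.

Local Open Scope classical_set_scope.
Local Open Scope ring_scope.

(* Derivatives relative to a set I, so that endpoints belonging to an interval
   I get one-sided derivatives; at interior points of I these are the usual
   derivatives. *)
Section DeriveWithin.
Context {R : realType} {V : normedModType R}.
Implicit Types (I : set R) (f : R -> V).

Definition diff_quot f (t s : R) : V := (s - t)^-1 *: (f s - f t).

Definition is_derive_within I f (t : R) (l : V) : Prop :=
  diff_quot f t s @[s --> within I t^'] --> l.

Definition derivable_within I f (t : R) : Prop :=
  cvg (diff_quot f t s @[s --> within I t^']).

Definition derive_within I f (t : R) : V :=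
  lim (diff_quot f t s @[s --> within I t^']).

Definition smooth_within I f : Prop :=
  forall (k : nat) (t : R), I t ->
    derivable_within I (iter k (derive_within I) f) t.

End DeriveWithin.

(* The integral of f from 0 to t, with the usual sign when t < 0. *)
Definition integral_from0 {R : realType} (f : R -> R) (t : R) : R :=
  if 0 <= t then \int[@lebesgue_measure R]_(x in `[0, t]) f x
  else - \int[@lebesgue_measure R]_(x in `[t, 0]) f x.

Definition coshR {R : realType} (x : R) : R := (expR x + expR (- x)) / 2.
Definition sinhR {R : realType} (x : R) : R := (expR x - expR (- x)) / 2.

Section Sl2.
Context {R : realType}.
Implicit Types (a b p q v w : 'M[R]_2) (I : set R) (c : R -> 'M[R]_2).

Definition sl2 : set 'M[R]_2 := [set a | \tr a = 0].
Definition SL2 : set 'M[R]_2 := [set a | \det a = 1].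

Definition lie a b := a *m b - b *m a.
Definition Ad (g a : 'M[R]_2) := g *m a *m invmx g.

Definition ip a b : R := 2 * \tr (a *m b).
Definition pnorm a : R := Num.sqrt `|ip a a|.

Lemma ip_sl2 a : sl2 a -> ip a a = - 4 * \det a.
Proof.
rewrite /sl2 /ip /= /mxtrace (expand_det_row _ 0) /cofactor.
rewrite !big_ord_recl !big_ord0 !det_mx11 !mxE.
rewrite !big_ord_recl !big_ord0 !addr0 /=.
have -> : lift ord0 ord0 = 1 :> 'I_2 by apply: val_inj.
have -> : lift 1 0 = 0 :> 'I_2 by apply: val_inj.
rewrite -![ord0]/(0 : 'I_2) => /eqP; rewrite addr_eq0 => /eqP ->.
by rewrite addn0 expr0 expr1; ring.
Qed.

Lemma pnorm_sl2 a : sl2 a -> pnorm a = 2 * Num.sqrt `|\det a|.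
Proof.
move=> /ip_sl2 aE; rewrite /pnorm aE normrM normrN (ger0_norm (ler0n _ 4)).
by rewrite sqrtrM // [4](natrX _ 2 2) sqrtr_sqr (ger0_norm (ler0n _ 2)).
Qed.

Definition unitize a : 'M[R]_2 := (pnorm a)^-1 *: a.

Definition H2 : set 'M[R]_2 := [set a | sl2 a /\ ip a a = -1].
Definition H11 : set 'M[R]_2 := [set a | sl2 a /\ ip a a = 1].

Lemma ip_unitize a : ip (unitize a) (unitize a) = ip a a / `|ip a a|.
Proof.
rewrite /ip /unitize -scalemxAl -scalemxAr !mxtraceZ.
rewrite -[X in _ = _ / X](sqr_sqrtr (normr_ge0 _)) -/(ip a a) -/(pnorm a).
by rewrite /ip -exprVn; ring.
Qed.

Lemma sl2_unitize a : sl2 a -> sl2 (unitize a).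
Proof. by rewrite /sl2 /= /unitize mxtraceZ => ->; rewrite mulr0. Qed.

Lemma unitize_H2 a : sl2 a -> 0 < \det a -> H2 (unitize a).
Proof.
move=> sa a0; split; first exact: sl2_unitize.
have ip0 : ip a a < 0 by rewrite ip_sl2// nmulr_rlt0// oppr_lt0.
by rewrite ip_unitize ltr0_norm// invrN mulrN divff// lt_eqF.
Qed.

Lemma unitize_H11 a : sl2 a -> \det a < 0 -> H11 (unitize a).
Proof.
move=> sa a0; split; first exact: sl2_unitize.
have ip0 : 0 < ip a a by rewrite ip_sl2// nmulr_rgt0// oppr_lt0.
by rewrite ip_unitize gtr0_norm// divff// gt_eqF.
Qed.

(* The tangent space at p of H2 (if p is in H2) or H11 (if p is in H11). *)
Definition tangent p : set 'M[R]_2 := [set v | sl2 v /\ ip p v = 0].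

(* For ip p p <> 0 and f linear on the tangent space at p, the linear extension
   of f to sl2 = R p (+) tangent p that maps p to q. *)
Definition extend_by p q (f : 'M[R]_2 -> 'M[R]_2) v : 'M[R]_2 :=
  let x := ip p v / ip p p in x *: q + f (v - x *: p).

Definition pseudo_rotation a (Phi : R) : 'M[R]_2 -> 'M[R]_2 :=
  let n := unitize a in
  extend_by n n (fun v =>
    if n \in H2 then cos Phi *: v + sin Phi *: lie n v
    else coshR Phi *: v + sinhR Phi *: lie n v).

Definition parallel I c (v : R -> 'M[R]_2) : Prop :=
  forall t, I t ->
    [/\ tangent (c t) (v t), derivable_within I v t &
        exists x : R, derive_within I v t = x *: c t].

(* Along a smooth curve c in H2 or H11 on an interval I containing 0 and t,
   there is exactly one candidate w for each v0 in the tangent space at c 0. *)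
Definition transport_tangent I c (t : R) v0 : 'M[R]_2 :=
  get [set w | exists v : R -> 'M[R]_2,
                     [/\ parallel I c v, v 0 = v0 & v t = w]].

Definition transport I c (t : R) : 'M[R]_2 -> 'M[R]_2 :=
  extend_by (c 0) (c t) (transport_tangent I c t).

Definition arc_derive I c (f : R -> 'M[R]_2) (t : R) : 'M[R]_2 :=
  (pnorm (derive_within I c t))^-1 *: derive_within I f t.

(* The coefficient k is unique where (c, c', lie c c') is a frame. *)
Definition geodesic_curvature I c (t : R) : R :=
  let c' := arc_derive I c c in
  let c'' := arc_derive I c c' in
  get [set k : R | exists x y : R,
         c'' t = x *: c t + y *: c' t + k *: lie (c t) (c' t)].

End Sl2.

(* Main.v *)
(* Conjugation by g^-1 satisfies [Ad_(g^-1) X]' = Ad_(g^-1) (X' + [X, a]), and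
   the correction [X, a] vanishes for X = n since n is parallel to a: this is the
   no-slip condition. For X = n' (arc-length derivative) the correction is
   - |a| [n, n'], whence the shift of the geodesic curvature by - |a| / |dn/dt|.
   Finally, if e is parallel along n, then rotating e about n by the angle Phi
   produces exactly the correction that makes Ad_(g^-1) (R[Phi] e) parallel along
   N, so parallel frames along n and N correspond. A parallel frame along n
   exists because the tangent bundle of H^2 or H^{1,1} has a global orthonormal
   frame (project a constant vector), relative to which parallel transport is the
   integration of a scalar angular velocity. In both cases we write
   eps = <n, n>, with (cos, sin) or (cosh, sinh) as eps = -1 or 1. *)
Require Import Defs.
From HB Require Import structures.
From mathcomp Require Import all_boot all_order all_algebra.
From mathcomp Require Import all_classical all_reals all_analysis.
From mathcomp Require Import ring lra.

Set Implicit Arguments.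
Unset Strict Implicit.
Unset Printing Implicit Defensive.

Import Order.TTheory GRing.Theory Num.Theory.
Import numFieldNormedType.Exports.

Local Open Scope classical_set_scope.
Local Open Scope ring_scope.

(** * Derivatives relative to an interval *)

Section DeriveWithinCalculus.
Context {R : realType} (I : set R).

Lemma near_within_dnbhs (t : R) (P : set R) :
  (\forall s \near within I t^', P s) <->
  exists2 d : R, 0 < d & forall s, I s -> s != t -> `|t - s| < d -> P s.
Proof.
rewrite /within /dnbhs /= -nbhs_nearE; split.
  move/nbhs_ballP => [d /= d0 H]; exists d => // s Is st ts.
  exact: (H s ts).
move=> [d d0 H]; apply/nbhs_ballP; exists d => //= s ts st Is.
exact: H.
Qed.

(** Points of the segment from [t] to [s] that are close to [t] lie in [I], so no punctured
    neighbourhood relative to [I] is empty. Properness is what makes relative derivatives unique. *)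
Lemma within_dnbhs_proper (t : R) (s : R) : is_interval I -> I s -> I t ->
  s != t -> ProperFilter (within I t^').
Proof.
move=> itvI Is It st; apply: Build_ProperFilter_ex => P /near_within_dnbhs[d d0 H].
(* The bound 1 keeps [t + e * (s - t)] on the segment from [t] to [s]; the other bound keeps it
   within [d / 2] of [t]. *)
pose e := Num.min 1 (d / 2 / `|s - t|).
have st0 : 0 < `|s - t| by rewrite normr_gt0 subr_eq0.
have e0 : 0 < e by rewrite lt_min ltr01 /= !divr_gt0.
have e1 : e <= 1 by rewrite ge_min lexx.
have ed : e * `|s - t| < d.
  apply: (@le_lt_trans _ _ (d / 2)); last by rewrite ltr_pdivrMr// ltr_pMr// ltr1n.
  by rewrite -ler_pdivlMr// ge_min lexx orbT.
exists (t + e * (s - t)); apply: H.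
- case: (ltgtP s t) st => // ts _.
    apply: (itvI s t) => //; apply/andP; split; nra.
  apply: (itvI t s) => //; apply/andP; split; nra.
- rewrite -subr_eq0 addrC addrA addNr add0r mulf_neq0 ?subr_eq0//.
  exact: lt0r_neq0.
- by rewrite opprD addrA subrr sub0r normrN normrM (gtr0_norm e0).
Qed.

Section Limits.
Context {V : normedModType R}.
Implicit Types (f g : R -> V) (t : R) (l : V).

(** The punctured filter does not see [t] itself, whence the separate condition at [t]. *)
Lemma is_derive_within_near f g t l : f t = g t ->
  {near within I t^', f =1 g} ->
  is_derive_within I f t l -> is_derive_within I g t l.
Proof.
move=> ft fg; apply: cvg_trans; apply: near_eq_cvg.
by near=> s; rewrite /diff_quot ft (near fg s).
Unshelve. all: by end_near. Qed.

Lemma eq_is_derive_within f g t l : I t -> {in I, f =1 g} ->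
  is_derive_within I f t l -> is_derive_within I g t l.
Proof.
move=> It fg; apply: is_derive_within_near; first by apply: fg; rewrite inE.
by apply/near_within_dnbhs; exists 1 => // s Is _ _; apply: fg; rewrite inE.
Qed.

Lemma is_derive_within_cvg f t l : is_derive_within I f t l ->
  f s @[s --> within I t^'] --> f t.
Proof.
move=> fl.
have H : f t + (s - t) *: diff_quot f t s @[s --> within I t^'] --> f t + 0 *: l.
  apply: cvgD; first exact: cvg_cst.
  apply: cvgZ => //.
  rewrite -(subrr t); apply: cvgB; last exact: cvg_cst.
  by apply: cvg_trans (@cvg_id _ (nbhs t)); apply: cvg_within_filter; apply: cvg_within.
move: H; rewrite scale0r addr0; apply: cvg_trans; apply: near_eq_cvg.
apply/near_within_dnbhs; exists 1 => // s Is st _.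
by rewrite /diff_quot scalerA divff ?subr_eq0// scale1r addrC subrK.
Qed.

End Limits.

Section Rules.
Context {V : normedModType R}.
Implicit Types (f g : R -> V) (t : R) (l : V).

Lemma is_derive_within_cst (c : V) t : is_derive_within I (cst c) t 0.
Proof.
rewrite /is_derive_within; under eq_fun do rewrite /diff_quot subrr scaler0.
exact: cvg_cst.
Qed.

Lemma is_derive_withinD f g t l m :
  is_derive_within I f t l -> is_derive_within I g t m ->
  is_derive_within I (fun s => f s + g s) t (l + m).
Proof.
move=> fl gm; rewrite /is_derive_within.
under eq_fun do rewrite /diff_quot opprD addrACA scalerDr.
exact: cvgD.
Qed.

Lemma is_derive_withinN f t l :
  is_derive_within I f t l -> is_derive_within I (fun s => - f s) t (- l).
Proof.
move=> fl; rewrite /is_derive_within.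
under eq_fun do rewrite /diff_quot -opprD scalerN.
exact: cvgN.
Qed.

Lemma is_derive_withinB f g t l m :
  is_derive_within I f t l -> is_derive_within I g t m ->
  is_derive_within I (fun s => f s - g s) t (l - m).
Proof. by move=> fl gm; apply: is_derive_withinD => //; apply: is_derive_withinN. Qed.

Lemma is_derive_withinZ (h : R -> R) f t (h' : R) l :
  is_derive_within I h t h' -> is_derive_within I f t l ->
  is_derive_within I (fun s => h s *: f s) t (h' *: f t + h t *: l).
Proof.
move=> hh' fl; rewrite /is_derive_within.
have -> : diff_quot (fun s => h s *: f s) t =
    fun s => diff_quot h t s *: f t + h s *: diff_quot f t s.
  apply/funext => s; rewrite -[diff_quot h t s]/((s - t)^-1 * (h s - h t)).
  rewrite /diff_quot -scalerA (scalerA (h s)) (mulrC (h s)) -scalerA -scalerDr.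
  by congr (_ *: _); rewrite scalerBl scalerBr [RHS]addrC addrA subrK.
apply: cvgD; first by apply: cvgZ => //; exact: cvg_cst.
by apply: cvgZ => //; exact: is_derive_within_cvg hh'.
Qed.

Lemma derive_within_unique f t l : ProperFilter (within I t^') ->
  is_derive_within I f t l -> derive_within I f t = l.
Proof. by move=> ?; apply: cvg_lim. Qed.

Lemma derivable_withinP f t :
  derivable_within I f t <-> exists l, is_derive_within I f t l.
Proof. by rewrite /derivable_within cvg_ex. Qed.

End Rules.

Lemma is_derive_within_scale {V : normedModType R} (x : R) (f : R -> V) t l :
  is_derive_within I f t l -> is_derive_within I (fun s => x *: f s) t (x *: l).
Proof.
move=> fl; rewrite -[x *: l]add0r -(scale0r (f t)).
exact: (is_derive_withinZ (is_derive_within_cst _ _)).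
Qed.

(** Carathéodory's argument: [q], the difference quotient of [h] at [f t] completed by the value
    [h'], is continuous at [f t]. The quotient of [h \o f] is [q (f s)] times that of [f], even at
    those [s] where [f s = f t]. *)
Lemma is_derive_within_comp (h f : R -> R) (t f' h' : R) :
  is_derive (f t) 1 h h' -> is_derive_within I f t f' ->
  is_derive_within I (h \o f) t (h' * f').
Proof.
move=> hh' ff'.
pose q y := if y == f t then h' else (y - f t)^-1 * (h y - h (f t)).
have cq : q y @[y --> f t] --> q (f t).
  rewrite /q eqxx; apply/cvgrPdist_lt => e e0.
  have [/cvgrPdist_lt/(_ e e0) + hE] := hh'.
  rewrite -/(derive h (f t) 1) hE.
  move/nbhs_ballP => [d /= d0 H].
  apply/nbhs_ballP; exists d => //= y yd.
  case: eqP => [_|/eqP yft]; first by rewrite subrr normr0.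
  have := H (y - f t); rewrite /ball /= sub0r normrN distrC => /(_ yd).
  by rewrite subr_eq0 => /(_ yft) /=; rewrite [_%:A]mulr1 subrK.
have cf : f s @[s --> within I t^'] --> f t by exact: is_derive_within_cvg ff'.
have cqf : (q \o f) s @[s --> within I t^'] --> q (f t) by exact: cvg_comp cq.
have qft : q (f t) = h' by rewrite /q eqxx.
rewrite qft in cqf.
have H : (q \o f) s * (diff_quot f t s : R) @[s --> within I t^'] --> h' * f'.
  exact: cvgM.
apply: cvg_trans H; apply: near_eq_cvg; near=> s.
rewrite /diff_quot /q /= /GRing.scale /=; case: eqP => [->|/eqP fst].
  by rewrite !subrr !mulr0.
move: fst (s - t)^-1; rewrite -subr_eq0 => fst v.
by field.
Unshelve. all: by end_near. Qed.

End DeriveWithinCalculus.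

(** * Mean value and intermediate value arguments on an interval *)

Section DeriveWithinInterval.
Context {R : realType} (I : set R).
Implicit Types (f : R -> R) (t : R).

Lemma is_derive_within_continuous {V : normedModType R} (f df : R -> V) :
  (forall t, I t -> is_derive_within I f t (df t)) -> {within I, continuous f}.
Proof.
move=> fdf; apply/subspace_continuousP => t It; apply/cvgrPdist_lt => e e0.
have /cvgrPdist_lt/(_ e e0)/near_within_dnbhs[d d0 H] :=
  is_derive_within_cvg (fdf t It).
rewrite /within /= -nbhs_nearE; apply/nbhs_ballP; exists d => //= s ts Is.
have [->|st] := eqVneq s t; first by rewrite subrr normr0.
exact: H.
Qed.

Lemma is_derive_is_derive_within f t (l : R) :
  is_derive t 1 f l -> is_derive_within I f t l.
Proof.
move=> [/cvgrPdist_lt + fl]; rewrite -/(derive f t 1) fl => H.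
apply/cvgrPdist_lt => e /H /nbhs_ballP[d /= d0 {}H].
apply/near_within_dnbhs; exists d => // s _ st ts.
have := H (s - t); rewrite /ball /= sub0r normrN distrC => /(_ ts).
by rewrite subr_eq0 => /(_ st) /=; rewrite [_%:A]mulr1 subrK.
Qed.

(** Strictly between two points of [I], all points near [t] belong to [I]. This gives access to the
    mean value theorem, which speaks of ordinary derivatives at interior points. *)
Lemma is_derive_within_is_derive f t (l x y : R) :
  is_interval I -> I x -> I y -> x < t < y ->
  is_derive_within I f t l -> is_derive t 1 f l.
Proof.
move=> itvI Ix Iy /andP[xt ty] /cvgrPdist_lt H.
have {}H : h^-1 *: ((f \o shift t) (h *: (1 : R)) - f t) @[h --> 0^'] --> l.
  apply/cvgrPdist_lt => e /H /near_within_dnbhs[d d0 {}H].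
  apply/nbhs_ballP; exists (Num.min d (Num.min (t - x) (y - t))) => /=.
    by rewrite !lt_min d0 !subr_gt0 xt.
  move=> h; rewrite /ball /= sub0r normrN !lt_min => /and3P[hd htx hyt] h0.
  have := H (h + t); rewrite /diff_quot addrK; rewrite [_%:A]mulr1; apply.
  - apply: (itvI x y) => //; move: htx hyt; rewrite !ltr_norml.
    by move=> /andP[? ?] /andP[? ?]; apply/andP; split; lra.
  - by rewrite -subr_eq0 addrK.
  - by rewrite opprD addrCA subrr addr0 normrN.
split; first by apply/cvg_ex; exists l.
exact: cvg_lim.
Qed.

Lemma derive_within0_eq f : is_interval I ->
  (forall t, I t -> is_derive_within I f t 0) ->
  {in I &, forall s t, f s = f t}.
Proof.
move=> itvI f0 s t; rewrite !inE; wlog : s t / s < t => [hw Is It|st Is It].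
  case: (ltgtP s t) => [st|ts|->//]; first exact: hw.
  by apply/esym; exact: hw.
have sub : `[s, t] `<=` I.
  by move=> u /=; rewrite in_itv /=; exact: itvI.
have [u|_ _] := @MVT R f (fun=> 0) s t st _
    (continuous_subspaceW sub (is_derive_within_continuous f0)).
  rewrite in_itv /= => sut.
  apply: (is_derive_within_is_derive itvI Is It sut); apply: f0.
  by apply: sub; rewrite /= in_itv /=; case/andP: sut => /ltW -> /ltW ->.
by rewrite mul0r => /eqP; rewrite subr_eq0 => /eqP.
Qed.

(** A change of sign would force a zero, by the intermediate value theorem. Applied to
    [ip (a t) (a t)], this keeps the normalized curve on a single pseudo-sphere. *)
Lemma continuous_within_gt0 f : is_interval I -> {within I, continuous f} ->
  (forall t, I t -> f t != 0) ->
  forall s t, I s -> I t -> 0 < f s -> 0 < f t.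
Proof.
move=> itvI cf f0 s t Is It fs; rewrite ltNge; apply/negP => ft.
have hw x y : I x -> I y -> x <= y ->
    Num.min (f x) (f y) <= 0 <= Num.max (f x) (f y) -> False.
  move=> Ix Iy xy /(IVT xy)[].
    apply: continuous_subspaceW cf => u /=; rewrite in_itv /=; exact: itvI.
  move=> u; rewrite in_itv /= => xuy /eqP; apply/negP; apply: f0.
  exact: itvI xuy.
case: (leP s t) => [st|/ltW ts].
  by apply: (hw s t) => //; rewrite ge_min le_max ft (ltW fs) orbT.
by apply: (hw t s) => //; rewrite ge_min le_max ft (ltW fs) orbT.
Qed.

End DeriveWithinInterval.

(** * The fundamental theorem of calculus relative to an interval *)

Section IntegralFrom0.
Context {R : realType}.
Implicit Types (f : R -> R) (t : R) (I : set R).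

(** The integral is based at a point [p] below both 0 and [t], so that [t] is interior to
    [[p, t + 1]] and the usual theorem applies. Subtracting the constant [F 0] recovers the signed
    integral on both sides of 0. *)
Lemma continuous_integral_from0_within I f t : continuous f ->
  is_derive_within I (integral_from0 f) t (f t).
Proof.
move=> cf; pose p := Num.min t 0 - 1.
have intf a b : (@lebesgue_measure R).-integrable `[a, b] (EFin \o f).
  apply: continuous_compact_integrable; first exact: segment_compact.
  exact: continuous_subspaceT.
have itvB x y : p <= x -> x <= y ->
    \int[@lebesgue_measure R]_(u in `[p, y]) f u -
      \int[@lebesgue_measure R]_(u in `[p, x]) f u =
    \int[@lebesgue_measure R]_(u in `[x, y]) f u.
  move=> px xy; rewrite Rintegral_itvB ?bnd_simp//.
  rewrite Rintegral_itv_obnd_cbnd//.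
  by apply: integrableS (intf x y) => //; exact: subset_itv_oc_cc.
pose F x := \int[@lebesgue_measure R]_(u in `[p, x]) f u.
have p0 : p <= 0 by rewrite /p lerBlDr ge_min add0r ler01 orbT.
have pt : p < t by rewrite /p ltrBlDr gt_min ltrDl ltr01.
have FE x : p <= x -> F x - F 0 = integral_from0 f x.
  move=> px; rewrite /integral_from0; case: (leP 0 x) => x0; first exact: itvB.
  by rewrite -itvB ?(ltW x0)// opprB.
have dF : is_derive_within I (fun x => F x - cst (F 0) x) t (f t).
  rewrite -[f t]subr0; apply: is_derive_withinB; last exact: is_derive_within_cst.
  apply: is_derive_is_derive_within.
  have tt1 : t < t + 1 by rewrite ltrDl.
  have [dF F'] := continuous_FTC1_closed tt1 (intf p (t + 1)) pt (cf t).
  by split; [exact: dF|rewrite -derive1E; exact: F'].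
apply: is_derive_within_near dF; first by rewrite FE// ltW.
apply/near_within_dnbhs; exists (t - p); rewrite ?subr_gt0// => s _ _.
by rewrite ltr_distlC => /andP[? _]; rewrite FE//; lra.
Qed.

(** Either [I] has a point beyond [t], which bounds a neighbourhood of [t], or [t] itself bounds
    [I]. Taking the maximum with 0 keeps 0 below the bound, so that the integral from 0 only sees
    values of [f] under it. *)
Lemma interval_near_upper_bound I t : I t -> I 0 -> exists q d : R,
  [/\ I q, 0 <= q, t <= q, 0 < d & forall s, I s -> `|t - s| < d -> s <= q].
Proof.
move=> It I0; have [[q Iq tq]|ub] := pselect (exists2 q, I q & t < q).
  exists (Num.max 0 q), (q - t).
  split; rewrite ?subr_gt0 ?le_max ?lexx ?(ltW tq) ?orbT//.
    by case: (leP 0 q).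
  by move=> s _; rewrite ltr_distlC le_max => /andP[_ sq]; apply/orP; right; lra.
exists (Num.max 0 t), 1; split; rewrite ?le_max ?lexx ?orbT//.
  by case: (leP 0 t).
move=> s Is _; rewrite le_max [s <= t]leNgt; apply/orP; right; apply/negP => ts.
by apply: ub; exists s.
Qed.

Lemma interval_near_lower_bound I t : I t -> I 0 -> exists p d : R,
  [/\ I p, p <= 0, p <= t, 0 < d & forall s, I s -> `|t - s| < d -> p <= s].
Proof.
move=> It I0.
have [||q [d [Iq q0 tq d0 H]]] := @interval_near_upper_bound (-%R @^-1` I) (- t).
- by rewrite /= opprK.
- by rewrite /= oppr0.
exists (- q), d; split => //; [lra|lra|move=> s Is ts].
rewrite lerNl; apply: H; first by rewrite /= opprK.
by rewrite -opprD normrN.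
Qed.

Lemma integral_from0_is_derive_within I f t : is_interval I -> I 0 ->
  {within I, continuous f} -> I t ->
  is_derive_within I (integral_from0 f) t (f t).
Proof.
move=> itvI I0 cf It.
have [q [d [Iq q0 tq d0 ubq]]] := interval_near_upper_bound It I0.
have [p [e [Ip p0 pt e0 lbp]]] := interval_near_lower_bound It I0.
(* Clipping to [p, q] makes f continuous on R, without changing it between 0 and
   the points of I near t. *)
pose clip x := Num.max p (Num.min q x).
have Iclip x : I (clip x).
  by apply: (itvI p q) => //; rewrite /clip le_max ge_max ge_min !lexx (le_trans p0 q0).
have clipE x : p <= x -> x <= q -> clip x = x.
  by move=> px xq; rewrite /clip (min_idPr xq) (max_idPr px).
have cclip : continuous clip.
  move=> x; apply: (@continuous_max R R (cst p) (fun x => Num.min q x) x).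
    exact: cst_continuous.
  by apply: (@continuous_min R R (cst q) id x); [exact: cst_continuous|exact: cvg_id].
have cfc : continuous (f \o clip).
  move=> x; have /subspace_continuousP/(_ _ (Iclip x)) cfx := cf.
  (* As [clip] takes all its values in [I], continuity of [f] relative to [I] is enough for
     continuity of the composite on the whole line. *)
  have cI : clip y @[y --> x] --> within I (nbhs (clip x)).
    move=> P /cclip IP; have {IP} : nbhs x [set y | I (clip y) -> P (clip y)] by [].
    move=> IP; suff : nbhs x [set y | P (clip y)] by [].
    by apply: filterS IP => y /=; apply; exact: Iclip.
  exact: cvg_comp cI cfx.
have intE s : p <= s -> s <= q ->
    integral_from0 (f \o clip) s = integral_from0 f s.
  move=> ps sq; rewrite /integral_from0; case: (leP 0 s) => s0.
    apply: eq_Rintegral => x; rewrite inE /= in_itv /= => /andP[x0 xs].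
    by rewrite clipE; [|lra|lra].
  congr (- _); apply: eq_Rintegral => x; rewrite inE /= in_itv /= => /andP[x0 xs].
  by rewrite clipE; [|lra|lra].
have := @continuous_integral_from0_within I _ t cfc; rewrite /= clipE//.
apply: is_derive_within_near; first exact: intE.
apply/near_within_dnbhs; exists (Num.min d e); first by rewrite lt_min d0.
move=> s Is _; rewrite lt_min => /andP[sd se]; apply: intE; [exact: lbp|exact: ubq].
Qed.

End IntegralFrom0.

(** * The Lie algebra sl2 *)

Section Sl2Algebra.
Context {R : realType}.
Implicit Types (a b c d n e u v w x : 'M[R]_2).

Lemma mx2P a b : a 0 0 = b 0 0 -> a 0 1 = b 0 1 -> a 1 0 = b 1 0 ->
  a 1 1 = b 1 1 -> a = b.
Proof.
move=> h00 h01 h10 h11; have ord2 (i : 'I_2) : i = 0 \/ i = 1.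
  by case: i => -[|[|//]] ?; [left|right]; exact: val_inj.
by apply/matrixP => i j; have [->|->] := ord2 i; have [->|->] := ord2 j.
Qed.

Lemma mulmx2E a b i j : (a *m b) i j = a i 0 * b 0 j + a i 1 * b 1 j.
Proof.
rewrite mxE !big_ord_recl big_ord0 addr0.
by have -> : lift ord0 ord0 = 1 :> 'I_2 by exact: val_inj.
Qed.

Lemma mxtrace2E a : \tr a = a 0 0 + a 1 1.
Proof.
rewrite /mxtrace !big_ord_recl big_ord0 addr0.
by have -> : lift ord0 ord0 = 1 :> 'I_2 by exact: val_inj.
Qed.

Lemma det2E a : \det a = a 0 0 * a 1 1 - a 0 1 * a 1 0.
Proof.
rewrite (expand_det_row _ 0) /cofactor !big_ord_recl !big_ord0 !det_mx11 !mxE.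
have -> : lift ord0 ord0 = 1 :> 'I_2 by apply: val_inj.
have -> : lift 1 0 = 0 :> 'I_2 by apply: val_inj.
by rewrite addn0 expr0 expr1 -![ord0]/(0 : 'I_2); ring.
Qed.

Lemma sl2E11 a : sl2 a -> a 1 1 = - a 0 0.
Proof. by rewrite /sl2 /= mxtrace2E addrC => /eqP; rewrite addr_eq0 => /eqP. Qed.

Lemma ipC a b : ip a b = ip b a.
Proof. by rewrite /ip mxtrace_mulC. Qed.

Lemma ipDl a b c : ip (a + b) c = ip a c + ip b c.
Proof. by rewrite /ip mulmxDl mxtraceD mulrDr. Qed.

Lemma ipZl (k : R) a b : ip (k *: a) b = k * ip a b.
Proof. by rewrite /ip -scalemxAl mxtraceZ mulrCA. Qed.

Lemma ipNl a b : ip (- a) b = - ip a b.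
Proof. by rewrite -scaleN1r ipZl mulN1r. Qed.

Lemma ipDr a b c : ip c (a + b) = ip c a + ip c b.
Proof. by rewrite ipC ipDl !(ipC c). Qed.

Lemma ipZr (k : R) a b : ip b (k *: a) = k * ip b a.
Proof. by rewrite ipC ipZl (ipC b). Qed.

Lemma ipNr a b : ip b (- a) = - ip b a.
Proof. by rewrite ipC ipNl (ipC b). Qed.

Definition ipE := (ipDl, ipDr, ipZl, ipZr, ipNl, ipNr).

Lemma lieC a b : lie a b = - lie b a.
Proof. by rewrite /lie opprB. Qed.

Lemma lievv a : lie a a = 0.
Proof. by rewrite /lie subrr. Qed.

Lemma lieDr a b c : lie c (a + b) = lie c a + lie c b.
Proof. by rewrite /lie mulmxDl mulmxDr opprD addrACA. Qed.

Lemma lieZr (k : R) a b : lie b (k *: a) = k *: lie b a.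
Proof. by rewrite /lie -scalemxAl -scalemxAr -scalerBr. Qed.

Lemma lieDl a b c : lie (a + b) c = lie a c + lie b c.
Proof. by rewrite lieC lieDr opprD -!lieC. Qed.

Lemma lieZl (k : R) a b : lie (k *: a) b = k *: lie a b.
Proof. by rewrite lieC lieZr -scalerN -lieC. Qed.

Lemma ip_lieA a b c : ip (lie a b) c = ip a (lie b c).
Proof.
rewrite /ip /lie mulmxBl mulmxBr !raddfB /=; congr (_ * (_ - _)).
  by rewrite mulmxA.
by rewrite -mulmxA mxtrace_mulC mulmxA.
Qed.

Lemma sl2_lie a b : sl2 (lie a b).
Proof. by rewrite /sl2 /= /lie raddfB /= mxtrace_mulC subrr. Qed.

Lemma sl2D a b : sl2 a -> sl2 b -> sl2 (a + b).
Proof. by rewrite /sl2 /= mxtraceD => -> ->; rewrite addr0. Qed.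

Lemma sl2Z (k : R) a : sl2 a -> sl2 (k *: a).
Proof. by rewrite /sl2 /= mxtraceZ => ->; rewrite mulr0. Qed.

Lemma sl2N a : sl2 a -> sl2 (- a).
Proof. by rewrite -scaleN1r; exact: sl2Z. Qed.

(** The triple product expansion of the cross product, transported to the bracket; the factor 2 in
    [ip] makes both coefficients 1. Together with the invariance [ip_lieA], it yields the frame
    identities below without coordinates. *)
Lemma lie_lie u v w : sl2 u -> sl2 v -> sl2 w ->
  lie (lie u v) w = ip v w *: u - ip u w *: v.
Proof.
move=> /sl2E11 hu /sl2E11 hv /sl2E11 hw.
by apply: mx2P; rewrite /lie /ip !mxtrace2E !(mulmx2E, mxE) ?hu ?hv ?hw; ring.
Qed.

Lemma ip_lie_lie a b c d : sl2 b -> sl2 c -> sl2 d ->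
  ip (lie a b) (lie c d) = ip c b * ip a d - ip d b * ip a c.
Proof.
by move=> sb sc sd; rewrite ip_lieA (lieC b) lie_lie// !ipE; ring.
Qed.

(** Bracketing with [n] squares to [eps] on the tangent plane: a complex structure for [eps = -1], a
    para-complex one for [eps = 1]. *)
Lemma lie_frame (eps : R) n v : sl2 n -> sl2 v -> ip n n = eps -> ip n v = 0 ->
  lie n (lie n v) = eps *: v.
Proof.
by move=> sn sv nn nv; rewrite lieC lie_lie// ipC nv nn scale0r sub0r opprK.
Qed.

Lemma ip_frame (eps eta : R) n e : sl2 n -> sl2 e ->
  ip n n = eps -> ip n e = 0 -> ip e e = eta ->
  [/\ ip n (lie n e) = 0, ip e (lie n e) = 0 &
      ip (lie n e) (lie n e) = - (eps * eta)].
Proof.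
move=> sn se nn ne ee; split.
- by rewrite -ip_lieA lievv -(scale0r n) ipZl mul0r.
- by rewrite ipC ip_lieA lievv -(scale0r n) ipZr mul0r.
- by rewrite ip_lie_lie// ne nn ee; ring.
Qed.

(** With [f = lie n e], the double bracket [lie (lie f x) f] is computed twice: by [lie_lie]
    directly, which produces [eps * eta] times [x] and a multiple of [f], and after expanding
    [lie f x] in terms of [n] and [e]. Comparison gives the expansion with no dimension count. The
    minus sign reflects [ip f f = - (eps * eta)]. *)
Lemma frame_decomp (eps eta : R) n e x : eps != 0 -> eta != 0 ->
  sl2 n -> sl2 e -> sl2 x -> ip n n = eps -> ip n e = 0 -> ip e e = eta ->
  x = (ip n x / eps) *: n + (ip e x / eta) *: e
      - (ip (lie n e) x / (eps * eta)) *: lie n e.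
Proof.
move=> eps0 eta0 sn se sx nn ne ee; set f := lie n e.
have [_ _ ff] := ip_frame sn se nn ne ee.
have fx : lie f x = ip e x *: n - ip n x *: e by exact: lie_lie.
have ef : lie e f = - (eta *: n).
  by rewrite lieC /f lie_lie// ee ne scale0r subr0.
have := lie_lie (sl2_lie n e : sl2 f) sx (sl2_lie n e : sl2 f).
rewrite fx ff lieDl -scaleNr !lieZl scaleNr (lie_frame sn se nn ne) ef.
rewrite -(ipC f) => H; apply: (@scalerI _ _ (eps * eta)); first by rewrite mulf_neq0.
rewrite scalerDr scalerDr scalerN !scalerA.
have -> : eps * eta * (ip n x / eps) = eta * ip n x by field.
have -> : eps * eta * (ip e x / eta) = eps * ip e x by field.
have -> : eps * eta * (ip f x / (eps * eta)) = ip f x by field; apply/andP.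
have -> : (eps * eta) *: x = ip e x *: (eps *: e) - ip n x *: - (eta *: n)
    - ip f x *: f.
  by rewrite H -(scaleNr _ x) opprK addrAC subrr add0r.
by rewrite scalerN opprK !scalerA (mulrC eta) (mulrC eps) (addrC (_ *: e)).
Qed.

(** Cayley-Hamilton in determinant 1. The inverse becomes linear in [g], hence as easy to
    differentiate as [g]. *)
Lemma invmx2E (g : 'M[R]_2) : \det g = 1 -> invmx g = (\tr g)%:M - g.
Proof.
move=> g1; have gu : g \in unitmx by rewrite unitmxE g1 unitr1.
have gX : g *m ((\tr g)%:M - g) = 1%:M.
  move: g1; rewrite det2E => g1.
  apply: mx2P; rewrite mulmx2E !mxE mxtrace2E /= -?g1 ?mulr1n ?mulr0n; ring.
by rewrite -[RHS](mulKmx gu) gX mulmx1.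
Qed.

Section Adjoint.
Variables (g : 'M[R]_2) (gu : g \in unitmx).

Lemma AdD a b : Ad g (a + b) = Ad g a + Ad g b.
Proof. by rewrite /Ad mulmxDr mulmxDl. Qed.

Lemma AdZ (k : R) a : Ad g (k *: a) = k *: Ad g a.
Proof. by rewrite /Ad -scalemxAr -scalemxAl. Qed.

Lemma AdN a : Ad g (- a) = - Ad g a.
Proof. by rewrite -scaleN1r AdZ scaleN1r. Qed.

Lemma Ad_mulmx a b : Ad g (a *m b) = Ad g a *m Ad g b.
Proof. by rewrite /Ad !mulmxA mulmxKV. Qed.

Lemma Ad_lie a b : Ad g (lie a b) = lie (Ad g a) (Ad g b).
Proof. by rewrite /lie AdD AdN !Ad_mulmx. Qed.

Lemma mxtrace_Ad a : \tr (Ad g a) = \tr a.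
Proof. by rewrite /Ad mxtrace_mulC mulmxA mulVmx// mul1mx. Qed.

Lemma ip_Ad a b : ip (Ad g a) (Ad g b) = ip a b.
Proof. by rewrite /ip -Ad_mulmx mxtrace_Ad. Qed.

Lemma sl2_Ad a : sl2 a -> sl2 (Ad g a).
Proof. by rewrite /sl2 /= mxtrace_Ad. Qed.

Lemma AdVK a : Ad g (Ad (invmx g) a) = a.
Proof. by rewrite /Ad invmxK !mulmxA mulmxV// mul1mx mulmxK. Qed.

End Adjoint.

End Sl2Algebra.

(** * Differentiation of matrix-valued curves *)

Section DeriveWithinMatrix.
Context {R : realType} (I : set R).
Implicit Types (F G : R -> 'M[R]_2) (t : R).

Lemma is_derive_within_mx F t (L : 'M[R]_2) :
  (forall i j, is_derive_within I (fun s => F s i j) t (L i j)) <->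
  is_derive_within I F t L.
Proof.
split=> [H|H i j].
  apply/cvg_ballP => e e0.
  have : \forall s \near within I t^', forall ij : 'I_2 * 'I_2,
      ball (L ij.1 ij.2) e (diff_quot (fun s => F s ij.1 ij.2) t s).
    by apply: filter_forall => -[i j]; have /cvg_ballP := H i j; exact.
  apply: filterS => s Hs; split => // i j.
  by have := Hs (i, j); rewrite /diff_quot /= !mxE.
have Hij : diff_quot F t s i j @[s --> within I t^'] --> L i j.
  apply: (@cvg_comp _ _ _ (diff_quot F t) (fun M : 'M[R]_2 => M i j) _ _ _ H).
  exact: coord_continuous.
apply: cvg_trans Hij; apply: near_eq_cvg; near=> s.
by rewrite /diff_quot /= !mxE.
Unshelve. all: by end_near. Qed.

Lemma is_derive_within_mulmx F G t (F' G' : 'M[R]_2) :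
  is_derive_within I F t F' -> is_derive_within I G t G' ->
  is_derive_within I (fun s => F s *m G s) t (F' *m G t + F t *m G').
Proof.
move=> /is_derive_within_mx FF' /is_derive_within_mx GG'.
apply/is_derive_within_mx => i j; under eq_fun do rewrite mulmx2E.
rewrite mxE !mulmx2E addrACA.
by apply: is_derive_withinD; apply: is_derive_withinZ.
Qed.

Lemma is_derive_within_lie F G t (F' G' : 'M[R]_2) :
  is_derive_within I F t F' -> is_derive_within I G t G' ->
  is_derive_within I (fun s => lie (F s) (G s)) t (lie F' (G t) + lie (F t) G').
Proof.
move=> FF' GG'; rewrite /lie addrACA -opprD (addrC (G t *m F')).
by apply: is_derive_withinB; apply: is_derive_within_mulmx.
Qed.

Lemma is_derive_within_mxtrace F t (F' : 'M[R]_2) :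
  is_derive_within I F t F' -> is_derive_within I (fun s => \tr (F s)) t (\tr F').
Proof.
move=> /is_derive_within_mx FF'; under eq_fun do rewrite mxtrace2E.
by rewrite mxtrace2E; apply: is_derive_withinD.
Qed.

Lemma is_derive_within_ip F G t (F' G' : 'M[R]_2) :
  is_derive_within I F t F' -> is_derive_within I G t G' ->
  is_derive_within I (fun s => ip (F s) (G s)) t (ip F' (G t) + ip (F t) G').
Proof.
move=> FF' GG'; rewrite /ip -mulrDr -mxtraceD.
rewrite -[_ * _]add0r -(mul0r (\tr (F t *m G t))).
apply: (is_derive_withinZ (is_derive_within_cst _ _ _)).
by apply: is_derive_within_mxtrace; apply: is_derive_within_mulmx.
Qed.

Lemma is_derive_within_sl2 F t (F' : 'M[R]_2) : ProperFilter (within I t^') ->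
  I t -> (forall s, I s -> sl2 (F s)) -> is_derive_within I F t F' -> sl2 F'.
Proof.
move=> pF It F0 /is_derive_within_mxtrace FF'.
rewrite /sl2 /= -(derive_within_unique pF FF'); apply: derive_within_unique.
by apply: eq_is_derive_within It _ (is_derive_within_cst _ 0 _) => s /[!inE] /F0.
Qed.

Lemma is_derive_within_ip_cst F G t (F' G' : 'M[R]_2) (k : R) :
  ProperFilter (within I t^') -> I t -> (forall s, I s -> ip (F s) (G s) = k) ->
  is_derive_within I F t F' -> is_derive_within I G t G' ->
  ip F' (G t) + ip (F t) G' = 0.
Proof.
move=> pF It FGk FF' GG'.
have <- := derive_within_unique pF (is_derive_within_ip FF' GG').
apply: derive_within_unique.
by apply: eq_is_derive_within It _ (is_derive_within_cst _ k _) => s /[!inE] /FGk.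
Qed.

Lemma is_derive_within_Ad_inv (a g : R -> 'M[R]_2) F t (F' : 'M[R]_2) :
  (forall s, I s -> sl2 (a s)) -> (forall s, I s -> SL2 (g s)) ->
  I t -> is_derive_within I g t (a t *m g t) -> is_derive_within I F t F' ->
  is_derive_within I (fun s => Ad (invmx (g s)) (F s)) t
    (Ad (invmx (g t)) (F' + lie (F t) (a t))).
Proof.
move=> sa sg It gg' FF'.
have gu : g t \in unitmx by rewrite unitmxE (sg t It) unitr1.
have hh' : is_derive_within I (fun s => invmx (g s)) t (- (invmx (g t) *m a t)).
  (* The adjugate of [a g] is [tr (a g) - a g]; it is also the product of the adjugates [g^-1] of
     [g] and [- a] of the traceless [a]. The right-hand side is the derivative of [tr g - g], in the
     shape that the product rule delivers. *)
  have -> : - (invmx (g t) *m a t) = \tr (a t *m g t) *: 1%:M + \tr (g t) *: 0 - a t *m g t.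
    rewrite scaler0 addr0 invmx2E ?(sg t It)// scalemx1; apply/esym.
    have := sl2E11 (sa t It) => a11.
    by apply: mx2P; rewrite !mxtrace2E !(mulmx2E, mxE) /= ?a11 ?mulr1n ?mulr0n; ring.
  apply: (@eq_is_derive_within _ _ _ (fun s => \tr (g s) *: 1%:M - g s)) It _ _.
    by move=> s /[!inE] Is; rewrite invmx2E ?(sg s Is)// scalemx1.
  apply: is_derive_withinB => //; apply: is_derive_withinZ.
    exact: is_derive_within_mxtrace.
  exact: is_derive_within_cst.
rewrite /Ad; under eq_fun do rewrite invmxK.
have := is_derive_within_mulmx (is_derive_within_mulmx hh' FF') gg'.
congr (is_derive_within _ _ _ _).
rewrite invmxK /lie !(mulmxDl, mulmxDr, mulNmx, mulmxN) !mulmxA.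
by rewrite -!addrA addrCA (addrC (- _)).
Qed.

End DeriveWithinMatrix.

(** * Inverses, absolute values and square roots *)

Section DeriveWithinReal.
Context {R : realType} (I : set R).
Implicit Types (f : R -> R) (t : R).

Lemma is_derive_withinV f t (f' : R) : f t != 0 ->
  is_derive_within I f t f' ->
  is_derive_within I (fun s => (f s)^-1) t (- (f t ^- 2) * f').
Proof.
move=> ft0; apply: (@is_derive_within_comp _ _ (fun x => x^-1)).
apply: is_derive_eq; first exact: (is_deriveV ft0 (is_derive_id _ _)).
by rewrite /GRing.scale /= mulr1.
Qed.

Lemma is_derive_within_norm f t (f' : R) : f t != 0 ->
  is_derive_within I f t f' ->
  is_derive_within I (fun s => `|f s|) t (Num.sg (f t) * f').
Proof.
move=> ft0 ff'; have cf := is_derive_within_cvg ff'.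
have H : is_derive_within I (fun s => Num.sg (f t) *: f s) t
    ((0 : R) *: f t + Num.sg (f t) *: f').
  by apply: is_derive_withinZ ff'; exact: is_derive_within_cst.
rewrite -[_ * f']add0r -(mul0r (f t)).
apply: is_derive_within_near H; first by rewrite /GRing.scale /= -normrEsg.
case: (ltgtP (f t) 0) ft0 => // ft _.
  near=> s; rewrite ltr0_sg// ltr0_norm ?scaleN1r//.
  by near: s; exact: (cvgr_lt (f t)).
near=> s; rewrite gtr0_sg// gtr0_norm ?scale1r//.
by near: s; exact: (cvgr_gt (f t)).
Unshelve. all: by end_near. Qed.

(** In this logarithmic form the derivative has the same expression for both signs of [f t], so the
    two pseudo-spheres need no separate treatment. *)
Lemma is_derive_within_sqrt_norm f t (f' : R) : f t != 0 ->
  is_derive_within I f t f' ->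
  is_derive_within I (fun s => Num.sqrt `|f s|) t
    (Num.sqrt `|f t| * f' / (2 * f t)).
Proof.
move=> ft0 ff'; have cf := is_derive_within_cvg ff'.
have nft0 : 0 < `|f t| by rewrite normr_gt0.
have := @is_derive_within_comp _ _ Num.sqrt (fun s => `|f s|) _ _ _
  (is_derive1_sqrt nft0) (is_derive_within_norm ft0 ff').
congr (is_derive_within _ _ _ _).
move: nft0; rewrite -sqrtr_gt0; set r := Num.sqrt _ => r0.
have -> : f t = Num.sg (f t) * r ^+ 2.
  by rewrite sqr_sqrtr// {1}[f t]numEsg.
have sg2 := sqr_sg (f t); rewrite ft0 /= in sg2.
have sg0 : Num.sg (f t) != 0 by rewrite sgr_eq0.
rewrite sgrM sgr_id (gtr0_sg (exprn_gt0 2 r0)) mulr1.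
apply: (mulfI sg0); rewrite mulrCA [X in _ * X]mulrA -expr2 sg2.
by field; rewrite sg0 gt_eqF.
Qed.

End DeriveWithinReal.

(** * Normalization of a differentiable curve *)

Section DerivableWithin.
Context {R : realType} (I : set R).
Implicit Types (f h : R -> R) (F G : R -> 'M[R]_2) (t : R).

Lemma derivable_withinE {V : normedModType R} (f : R -> V) t :
  derivable_within I f t -> is_derive_within I f t (derive_within I f t).
Proof. by []. Qed.

Lemma is_derive_within_derivable {V : normedModType R} (f : R -> V) t l :
  is_derive_within I f t l -> derivable_within I f t.
Proof. by move=> fl; apply/derivable_withinP; exists l. Qed.

Lemma eq_derivable_within {V : normedModType R} (f g : R -> V) t :
  I t -> {in I, f =1 g} -> derivable_within I f t -> derivable_within I g t.
Proof.
move=> It fg /derivable_withinP[l fl]; apply/derivable_withinP; exists l.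
exact: eq_is_derive_within fl.
Qed.

Lemma derivable_within_continuous {V : normedModType R} (f : R -> V) :
  (forall t, I t -> derivable_within I f t) -> {within I, continuous f}.
Proof. exact: is_derive_within_continuous. Qed.

Lemma derivable_withinD {V : normedModType R} (f g : R -> V) t :
  derivable_within I f t -> derivable_within I g t ->
  derivable_within I (fun s => f s + g s) t.
Proof.
by move=> fd gd; apply: is_derive_within_derivable (is_derive_withinD fd gd).
Qed.

Lemma derivable_withinB {V : normedModType R} (f g : R -> V) t :
  derivable_within I f t -> derivable_within I g t ->
  derivable_within I (fun s => f s - g s) t.
Proof.
by move=> fd gd; apply: is_derive_within_derivable (is_derive_withinB fd gd).
Qed.

Lemma derivable_withinZ {V : normedModType R} h (f : R -> V) t :
  derivable_within I h t -> derivable_within I f t ->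
  derivable_within I (fun s => h s *: f s) t.
Proof.
by move=> hd fd; apply: is_derive_within_derivable (is_derive_withinZ hd fd).
Qed.

Lemma derivable_within_cst {V : normedModType R} (c : V) t :
  derivable_within I (fun=> c) t.
Proof. exact: is_derive_within_derivable (is_derive_within_cst I c t). Qed.

Lemma derivable_withinV f t : f t != 0 ->
  derivable_within I f t -> derivable_within I (fun s => (f s)^-1) t.
Proof.
by move=> ft0 fd; apply: is_derive_within_derivable (is_derive_withinV ft0 fd).
Qed.

Lemma derivable_within_ip F G t :
  derivable_within I F t -> derivable_within I G t ->
  derivable_within I (fun s => ip (F s) (G s)) t.
Proof.
by move=> Fd Gd; apply: is_derive_within_derivable (is_derive_within_ip Fd Gd).
Qed.

Lemma derivable_within_lie F G t :
  derivable_within I F t -> derivable_within I G t ->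
  derivable_within I (fun s => lie (F s) (G s)) t.
Proof.
by move=> Fd Gd; apply: is_derive_within_derivable (is_derive_within_lie Fd Gd).
Qed.

Lemma is_derive_within_pnorm F t (F' : 'M[R]_2) : ip (F t) (F t) != 0 ->
  is_derive_within I F t F' ->
  is_derive_within I (fun s => pnorm (F s)) t
    (pnorm (F t) * (ip (F t) F' / ip (F t) (F t))).
Proof.
move=> F0 FF'; have := @is_derive_within_sqrt_norm _ _ (fun s => ip (F s) (F s)) _ _ F0
  (is_derive_within_ip FF' FF').
congr (is_derive_within _ _ _ _); rewrite (ipC F') -/(pnorm (F t)).
by field.
Qed.

Lemma pnorm_neq0 (a : 'M[R]_2) : (pnorm a != 0) = (ip a a != 0).
Proof. by rewrite /pnorm sqrtr_eq0 -ltNge normr_gt0. Qed.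

(** The derivative is the part of [F'] orthogonal to [F t], divided by the norm of [F t]. *)
Lemma is_derive_within_unitize F t (F' : 'M[R]_2) : ip (F t) (F t) != 0 ->
  is_derive_within I F t F' ->
  is_derive_within I (fun s => unitize (F s)) t
    ((pnorm (F t))^-1 *: (F' - (ip (F t) F' / ip (F t) (F t)) *: F t)).
Proof.
move=> F0 FF'; have p0 : pnorm (F t) != 0 by rewrite pnorm_neq0.
have := is_derive_withinZ (@is_derive_withinV _ _ (fun s => pnorm (F s)) _ _ p0
  (is_derive_within_pnorm F0 FF')) FF'.
congr (is_derive_within _ _ _ _); rewrite scalerBr addrC; congr (_ + _).
rewrite scalerA -scaleNr; congr (_ *: _); rewrite expr2.
by field; rewrite p0 F0.
Qed.

(** The regularity called for by the geodesic curvature and by the continuity of the angular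
    velocity of a moving frame. *)
Definition twice_derivable F := forall t, I t ->
  derivable_within I F t /\ derivable_within I (derive_within I F) t.

Lemma twice_derivable_unitize F : (forall t, I t -> ProperFilter (within I t^')) ->
  (forall t, I t -> ip (F t) (F t) != 0) -> twice_derivable F ->
  twice_derivable (fun s => unitize (F s)).
Proof.
move=> pF F0 dF t It; have [dt ddt] := dF t It; have q0 := F0 t It.
split; first exact: is_derive_within_derivable (is_derive_within_unitize q0 dt).
(* The first derivative is replaced by its explicit formula, valid on all of [I], whose factors are
   derivable one by one. *)
apply: (@eq_derivable_within _ (fun s => (pnorm (F s))^-1 *: (derive_within I F s -
    (ip (F s) (derive_within I F s) * (ip (F s) (F s))^-1) *: F s))) It _ _.
  move=> s /[!inE] Is; apply/esym/derive_within_unique; first exact: pF.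
  by have [ds _] := dF s Is; exact: (is_derive_within_unitize (F0 s Is) ds).
apply: derivable_withinZ.
  apply: (@derivable_withinV (fun s => pnorm (F s))); first by rewrite pnorm_neq0.
  exact: is_derive_within_derivable (is_derive_within_pnorm q0 dt).
apply: derivable_withinB; first exact: ddt.
apply: derivable_withinZ; last exact: dt.
apply: (@derivable_withinZ R); first exact: derivable_within_ip.
by apply: (@derivable_withinV (fun s => ip (F s) (F s))) => //; exact: derivable_within_ip.
Qed.

End DerivableWithin.

(** * Parallel transport *)

Section ParallelTransport.
Context {R : realType} (I : set R).
Hypotheses (itvI : is_interval I) (I0 : I 0).
Hypothesis pF : forall t, I t -> ProperFilter (within I t^').
Variables (c : R -> 'M[R]_2) (eps : R).
Hypotheses (eps0 : eps != 0) (sl2c : forall t, I t -> sl2 (c t)).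
Hypothesis (ip_cc : forall t, I t -> ip (c t) (c t) = eps).
Hypothesis (dc : forall t, I t -> derivable_within I c t).
Implicit Types (v w e : R -> 'M[R]_2) (t : R).

Lemma parallel_intro v : (forall t, I t -> tangent (c t) (v t)) ->
  (forall t, I t -> exists x, is_derive_within I v t (x *: c t)) ->
  parallel I c v.
Proof.
move=> vt dv t It; have [x vx] := dv t It; split; first exact: vt.
  exact: is_derive_within_derivable vx.
by exists x; apply: derive_within_unique vx; exact: pF.
Qed.

Lemma parallel_is_derive v t : parallel I c v -> I t ->
  exists x, is_derive_within I v t (x *: c t).
Proof.
by move=> pv /pv[_ dv [x xE]]; exists x; rewrite -xE; exact: derivable_withinE.
Qed.

(** Both derivatives are multiples of [c], which is orthogonal to [v] and [w]; so the inner product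
    has derivative 0. *)
Lemma parallel_ip v w t : parallel I c v -> parallel I c w -> I t ->
  ip (v t) (w t) = ip (v 0) (w 0).
Proof.
move=> pv pw It.
apply: (@derive_within0_eq _ I (fun s => ip (v s) (w s))); rewrite ?inE//.
move=> s Is; have [x vx] := parallel_is_derive pv Is.
have [y wy] := parallel_is_derive pw Is.
have := is_derive_within_ip vx wy; congr (is_derive_within _ _ _ _).
have [[_ cv] _ _] := pv s Is; have [[_ cw] _ _] := pw s Is.
by rewrite ipZl ipZr cw (ipC (v s)) cv !mulr0 addr0.
Qed.

Lemma parallel_lin (x y : R) v w : parallel I c v -> parallel I c w ->
  parallel I c (fun s => x *: v s + y *: w s).
Proof.
move=> pv pw; apply: parallel_intro => t It.
  have [[sv cv] _ _] := pv t It; have [[sw cw] _ _] := pw t It.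
  split; first by apply: sl2D; exact: sl2Z.
  by rewrite !ipE cv cw !mulr0 addr0.
have [k vk] := parallel_is_derive pv It; have [l wl] := parallel_is_derive pw It.
exists (x * k + y * l); rewrite scalerDl -!scalerA.
by apply: is_derive_withinD; exact: is_derive_within_scale.
Qed.

(** By [lie_lie], [lie v w] commutes with [n]. Bracketing with [n] once more and expanding turns
    this into proportionality to [n]. *)
Lemma lie_tangent (n v w : 'M[R]_2) : ip n n = eps -> tangent n v -> tangent n w ->
  sl2 n -> exists x, lie v w = x *: n.
Proof.
move=> nn [sv nv] [sw nw] sn; exists (ip n (lie v w) / eps).
have h : lie (lie v w) n = 0.
  by rewrite lie_lie// (ipC w) (ipC v) nv nw !scale0r subrr.
have := lie_lie (sl2_lie v w) sn sn; rewrite h -(scale0r n) lieZl scale0r nn.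
move=> /esym/eqP; rewrite subr_eq0 => /eqP H.
apply: (@scalerI _ _ eps) => //; rewrite H ipC scalerA; congr (_ *: _).
by field.
Qed.

Lemma tangent_derive t : I t -> tangent (c t) (derive_within I c t).
Proof.
move=> It; have dct := derivable_withinE (dc It).
split; first exact: is_derive_within_sl2 (pF It) It sl2c dct.
have := is_derive_within_ip_cst (pF It) It ip_cc dct dct.
by rewrite ipC -mulr2n => /eqP; rewrite mulrn_eq0 /= => /eqP.
Qed.

(** In the derivative [lie c' v + lie c v'], the first term is normal by [lie_tangent] and the
    second vanishes since [v'] is a multiple of [c]. One parallel field thus yields a whole parallel
    frame. *)
Lemma parallel_lie v : parallel I c v -> parallel I c (fun s => lie (c s) (v s)).
Proof.
move=> pv; apply: parallel_intro => t It; have [[sv cv] _ _] := pv t It.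
  split; first exact: sl2_lie.
  by rewrite -ip_lieA lievv -(scale0r (c t)) ipZl mul0r.
have [k vk] := parallel_is_derive pv It.
have [x xE] := lie_tangent (ip_cc It) (tangent_derive It) (conj sv cv) (sl2c It).
exists x; have := is_derive_within_lie (dc It) vk.
by rewrite lieZr lievv scaler0 addr0 -xE.
Qed.

Section Frame.
Variables (e : R -> 'M[R]_2) (eta : R).
Hypotheses (eta0 : eta != 0) (pe : parallel I c e).
Hypothesis ip_ee : ip (e 0) (e 0) = eta.
Let f s := lie (c s) (e s).

Let ip_eet t : I t -> ip (e t) (e t) = eta.
Proof. by move=> It; rewrite (parallel_ip pe pe It). Qed.

Let ip_ce t : I t -> ip (c t) (e t) = 0.
Proof. by move=> /pe[[_ ->]]. Qed.

Let sl2e t : I t -> sl2 (e t).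
Proof. by move=> /pe[[]]. Qed.

Let pf : parallel I c f. Proof. exact: parallel_lie. Qed.

Let f_frame t : I t -> [/\ ip (c t) (f t) = 0, ip (e t) (f t) = 0 &
  ip (f t) (f t) = - (eps * eta)].
Proof.
move=> It.
exact: (ip_frame (sl2c It) (sl2e It) (ip_cc It) (ip_ce It) (ip_eet It)).
Qed.

(** Combinations of [e] and [f] with constant coefficients are parallel, which gives existence. Any
    parallel field has constant inner products with [e] and [f], hence constant coordinates, which
    gives uniqueness. *)
Lemma transport_tangent_frame t (v : 'M[R]_2) : I t -> tangent (c 0) v ->
  transport_tangent I c t v =
  (ip (e 0) v / eta) *: e t - (ip (f 0) v / (eps * eta)) *: f t.
Proof.
move=> It [sv cv]; rewrite /transport_tangent.
set W := [set w | _]; set w0 := RHS.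
have decomp0 := frame_decomp eps0 eta0 (sl2c I0) (sl2e I0) sv (ip_cc I0)
  (ip_ce I0) ip_ee.
have W0 : W w0.
  exists (fun s => (ip (e 0) v / eta) *: e s + (- (ip (f 0) v / (eps * eta))) *: f s).
  split; [exact: parallel_lin| |by rewrite scaleNr].
  by rewrite [RHS]decomp0 cv mul0r scale0r add0r scaleNr.
(* Whatever value [get] selects, its coordinates are forced by those of [v] at time 0. *)
have : W (get W) by apply: getI W0.
move=> [u [pu u0 <-]].
have [[su cu] _ _] := pu t It.
rewrite (frame_decomp eps0 eta0 (sl2c It) (sl2e It) su (ip_cc It)
  (ip_ce It) (ip_eet It)) cu mul0r scale0r add0r.
by rewrite (parallel_ip pe pu It) -/(f t) (parallel_ip pf pu It) u0.
Qed.

Lemma transport_frame t (x : 'M[R]_2) : I t -> sl2 x ->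
  transport I c t x = (ip (c 0) x / eps) *: c t +
    (ip (e 0) x / eta) *: e t - (ip (f 0) x / (eps * eta)) *: f t.
Proof.
move=> It sx; rewrite /transport /extend_by (ip_cc I0).
set k := ip _ _ / eps.
have [cf _ _] := f_frame I0.
rewrite transport_tangent_frame//; last first.
  split; first by apply: sl2D => //; apply: sl2N; apply: sl2Z; exact: sl2c.
  by rewrite !ipE ip_cc// /k; field.
(* Abstract [f 0], which would otherwise unfold to a difference. *)
move: (f 0) cf => f0 cf.
rewrite !ipE (ipC (e 0) (c 0)) (ip_ce I0) (ipC f0 (c 0)) cf.
by rewrite mulr0 oppr0 !addr0 addrA.
Qed.

Lemma transport_comb t (x y z : R) : I t ->
  transport I c t (x *: c 0 + y *: e 0 + z *: f 0) = x *: c t + y *: e t + z *: f t.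
Proof.
move=> It.
have [cf ef ff] := f_frame I0.
rewrite transport_frame//; last first.
  by apply: sl2D; [apply: sl2D|]; apply: sl2Z; [exact: sl2c|exact: sl2e|exact: sl2_lie].
move: (f 0) cf ef ff => f0 cf ef ff.
rewrite !ipE (ipC (e 0) (c 0)) (ipC f0 (c 0)) (ipC f0 (e 0)).
rewrite (ip_ce I0) cf ef ff (ip_cc I0) ip_ee.
by rewrite -scaleNr; congr (_ *: _ + _ *: _ + _ *: _); field; rewrite ?eps0 ?eta0.
Qed.

(** Transport preserves the inner products with the three frame vectors, and these determine an
    element of [sl2]. Injectivity on [sl2] is what allows the partial inverse to be computed. *)
Lemma transport_inj t : I t -> {in sl2 &, injective (transport I c t)}.
Proof.
move=> It x y /[!inE] sx sy.
have [cf ef ff] := f_frame It.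
have coord u : sl2 u ->
  [/\ ip (c t) (transport I c t u) = ip (c 0) u,
      ip (e t) (transport I c t u) = ip (e 0) u &
      ip (f t) (transport I c t u) = ip (f 0) u].
  move=> su; rewrite transport_frame//.
  move: (f 0) (f t) cf ef ff => f0 ft cf ef ff; rewrite !ipE.
  rewrite (ipC (e t) (c t)) (ipC ft (c t)) (ipC ft (e t)).
  rewrite (ip_ce It) cf ef ff (ip_cc It) (ip_eet It).
  by split; field; rewrite ?eps0 ?eta0.
have [x1 x2 x3] := coord x sx; have [y1 y2 y3] := coord y sy.
move=> txy; rewrite txy in x1 x2 x3.
rewrite (frame_decomp eps0 eta0 (sl2c I0) (sl2e I0) sx (ip_cc I0) (ip_ce I0) ip_ee).
rewrite [RHS](frame_decomp eps0 eta0 (sl2c I0) (sl2e I0) sy (ip_cc I0) (ip_ce I0) ip_ee).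
by rewrite -[lie (c 0) (e 0)]/(f 0) -x1 -x2 -x3 y1 y2 y3.
Qed.

Lemma pinv_transport_comb t (x y z : R) : I t ->
  'pinv_(fun=> 0) sl2 (transport I c t) (x *: c t + y *: e t + z *: f t) =
  x *: c 0 + y *: e 0 + z *: f 0.
Proof.
move=> It; rewrite -transport_comb// pinvKV//; first exact: transport_inj.
rewrite inE.
by apply: sl2D; [apply: sl2D|]; apply: sl2Z; [exact: sl2c|exact: sl2e|exact: sl2_lie].
Qed.

End Frame.

End ParallelTransport.

(** * Circular and hyperbolic rotations in a common notation *)

Section Rotation.
Context {R : realType}.
Implicit Types (eps x : R).

(** One pair [C], [S] for both geometries: when [eps] is 1 or -1, [C' = eps S], [S' = C] and
    [C^2 - eps S^2 = 1]. *)
Definition rot_cos eps x := if eps == -1 then cos x else coshR x.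
Definition rot_sin eps x := if eps == -1 then sin x else sinhR x.

Lemma is_derive_expRN x : is_derive x 1 (fun y : R => expR (- y)) (- expR (- x)).
Proof.
have := @is_derive1_comp R expR -%R x _ _ (is_derive_expR _) (is_deriveNid x 1).
by rewrite mulrN1.
Qed.

Lemma is_derive_coshR x : is_derive x 1 coshR (sinhR x).
Proof.
rewrite /coshR /sinhR; have H := is_derive_expRN x.
apply: is_derive_eq.
by rewrite /GRing.scale /= !mulr0 add0r mulrC.
Qed.

Lemma is_derive_sinhR x : is_derive x 1 sinhR (coshR x).
Proof.
rewrite /coshR /sinhR; have H := is_derive_expRN x.
apply: is_derive_eq.
by rewrite /GRing.scale /= !mulr0 add0r mulrC opprK.
Qed.

Lemma is_derive_rot_cos eps x : eps = 1 \/ eps = -1 ->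
  is_derive x 1 (rot_cos eps) (eps * rot_sin eps x).
Proof.
move=> [->|->]; rewrite /rot_cos /rot_sin.
  have -> : (1 == -1 :> R) = false by apply/negbTE/eqP; lra.
  by rewrite mul1r; exact: is_derive_coshR.
by rewrite eqxx mulN1r; exact: is_derive_cos.
Qed.

Lemma is_derive_rot_sin eps x : is_derive x 1 (rot_sin eps) (rot_cos eps x).
Proof.
rewrite /rot_cos /rot_sin; case: ifP => _; first exact: is_derive_sin.
exact: is_derive_sinhR.
Qed.

Lemma rot_cos0 eps : rot_cos eps 0 = 1.
Proof.
rewrite /rot_cos /coshR cos0 oppr0 expR0; by case: ifP => // _; field.
Qed.

Lemma rot_sin0 eps : rot_sin eps 0 = 0.
Proof. by rewrite /rot_sin /sinhR sin0 oppr0 subrr mul0r if_same. Qed.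

Lemma rot_cos2Bsin2 eps x : eps = 1 \/ eps = -1 ->
  rot_cos eps x ^+ 2 - eps * rot_sin eps x ^+ 2 = 1.
Proof.
move=> [->|->]; rewrite /rot_cos /rot_sin.
  have -> : (1 == -1 :> R) = false by apply/negbTE/eqP; lra.
  have := expRN x; have := expR_gt0 x; rewrite /coshR /sinhR => x0 ->.
  by field; rewrite gt_eqF.
by rewrite eqxx mulN1r opprK cos2Dsin2.
Qed.

(** The matrix of the rotation in the frame [(n, e, f)]: the entry [eps * rot_sin eps Phi] comes
    from [lie n f = eps *: e]. *)
Lemma pseudo_rotation_comb (a e : 'M[R]_2) eps (Phi x y z : R) :
  let n := unitize a in let f := lie n e in
  eps = 1 \/ eps = -1 -> sl2 n -> sl2 e -> ip n n = eps -> ip n e = 0 ->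
  pseudo_rotation a Phi (x *: n + y *: e + z *: f) =
  x *: n + (y * rot_cos eps Phi + z * (eps * rot_sin eps Phi)) *: e +
  (y * rot_sin eps Phi + z * rot_cos eps Phi) *: f.
Proof.
move=> n f eps1 sn se nn ne.
have eps0 : eps != 0 by case: eps1 => ->; rewrite ?oppr_eq0 oner_neq0.
have nf : ip n f = 0 by rewrite -ip_lieA lievv -(scale0r n) ipZl mul0r.
have nf' : lie n f = eps *: e by exact: lie_frame.
have H2E : (n \in H2) = (eps == -1).
  apply/idP/eqP; first by rewrite inE => -[_ <-].
  by move=> e1; rewrite inE; split => //; rewrite nn.
rewrite /pseudo_rotation -/n H2E /extend_by.
have nE : lie n e = f by [].
clearbody f; clearbody n.
have -> : ip n (x *: n + y *: e + z *: f) / ip n n = x.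
  by rewrite !ipE ne nf nn; field.
have -> : x *: n + y *: e + z *: f - x *: n = y *: e + z *: f.
  by rewrite -(addrA (x *: n)) addrAC subrr add0r.
rewrite lieDr !lieZr nE nf' /rot_cos /rot_sin.
by case: ifP => _; apply/matrixP => i j; rewrite !mxE; ring.
Qed.

End Rotation.

(** * Existence of a parallel field of constant nonzero square *)

Section ParallelFrame.
Context {R : realType} (I : set R).
Hypotheses (itvI : is_interval I) (I0 : I 0).
Hypothesis pF : forall t, I t -> ProperFilter (within I t^').
Variables (c : R -> 'M[R]_2) (eps : R).
Hypotheses (eps1 : eps = 1 \/ eps = -1) (sl2c : forall t, I t -> sl2 (c t)).
Hypothesis (ip_cc : forall t, I t -> ip (c t) (c t) = eps).

Let eps0 : eps != 0.
Proof. by case: eps1 => ->; rewrite ?oppr_eq0 oner_neq0. Qed.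

Let eps2 : eps * eps = 1.
Proof. by case: eps1 => ->; rewrite ?mulrNN mulr1. Qed.

Lemma exists_sl2_ip : exists2 k : 'M[R]_2, sl2 k & ip k k = - eps.
Proof.
(* For [eps = -1] this is half of [diag(1, -1)], of square 1; for [eps = 1] it is half of the
   generator of plane rotations, of square -1. *)
exists (\matrix_(i, j) if i == j then (if eps == -1 then (-1) ^+ i / 2 else 0)
  else (if eps == -1 then 0 else (-1) ^+ i / 2)).
  by rewrite /sl2 /= mxtrace2E !mxE /=; case: ifP => _; rewrite ?expr0 ?expr1; field.
rewrite /ip mxtrace2E !mulmx2E !mxE /= expr0 expr1.
case: ifPn => [/eqP ->|eN1]; first by field.
have -> : eps = 1 by case: eps1 => // e; rewrite e eqxx in eN1.
by field.
Qed.

Lemma twice_derivable_intro (F F1 : R -> 'M[R]_2) :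
  (forall t, I t -> is_derive_within I F t (F1 t)) ->
  (forall t, I t -> derivable_within I F1 t) -> twice_derivable I F.
Proof.
move=> FF1 dF1 t It; split; first exact: is_derive_within_derivable (FF1 t It).
apply: eq_derivable_within It _ (dF1 t It) => s /[!inE] Is.
by apply/esym/derive_within_unique; [exact: pF|exact: FF1].
Qed.

(* The normalized tangential part of a constant vector k with <k, k> = - eps:
   it never degenerates because its square is - eps (1 + <k, c>^2). *)
Lemma exists_unit_tangent : twice_derivable I c ->
  exists e : R -> 'M[R]_2, twice_derivable I e /\
    forall t, I t -> tangent (c t) (e t) /\ ip (e t) (e t) = - eps.
Proof.
move=> ddc; have [k sk kk] := exists_sl2_ip.
(* Since [eps] is its own inverse, multiplying by it divides by [ip (c s) (c s)], so [u] is the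
   orthogonal projection of [k]. *)
pose u s := k - ((eps * ip k (c s)) : R) *: c s.
have ip_uu t : I t -> ip (u t) (u t) = - eps * (1 + ip k (c t) ^+ 2).
  move=> It; rewrite !ipE (ipC (c t) k) kk (ip_cc It).
  by case: eps1 => ->; ring.
have pos t : 0 < 1 + ip k (c t) ^+ 2 by rewrite ltr_pwDl// sqr_ge0.
have uu0 t : I t -> ip (u t) (u t) != 0.
  by move=> It; rewrite ip_uu// mulf_neq0 ?oppr_eq0// gt_eqF.
have ddu : twice_derivable I u.
  apply: (@twice_derivable_intro _ (fun s => 0 -
    ((eps * ip k (derive_within I c s)) *: c s +
     (eps * ip k (c s)) *: derive_within I c s))) => t It.
    have [dct _] := ddc t It.
    apply: is_derive_withinB; first exact: is_derive_within_cst.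
    apply: is_derive_withinZ => //.
    have := @is_derive_within_scale _ I _ eps _ _ _
      (is_derive_within_ip (is_derive_within_cst I k t) dct).
    by rewrite -(scale0r k) ipZl mul0r add0r.
  have [dct ddct] := ddc t It.
  have dk (F : R -> 'M[R]_2) : derivable_within I F t ->
      derivable_within I (fun s => eps * ip k (F s)) t.
    move=> dF; apply: (@derivable_withinZ R I R (fun=> eps)).
      exact: derivable_within_cst.
    by apply: derivable_within_ip dF; exact: derivable_within_cst.
  apply: derivable_withinB; first exact: derivable_within_cst.
  by apply: derivable_withinD; apply: derivable_withinZ; rewrite //; exact: dk.
exists (fun s => unitize (u s)); split.
  exact: twice_derivable_unitize.
move=> t It; split; last first.
  rewrite ip_unitize ip_uu// normrM (gtr0_norm (pos t)) normrN.
  have -> : `|eps| = 1 by case: eps1 => ->; rewrite ?normrN normr1.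
  by rewrite mul1r mulfK// gt_eqF.
split.
  apply/sl2_unitize/sl2D => //; apply: sl2N; apply: sl2Z; exact: sl2c.
rewrite /unitize ipZr ipDr ipNr ipZr (ip_cc It) (ipC (c t)).
by case: eps1 => ->; ring.
Qed.

(** With a unit tangent field [e] and [f = lie c e], modulo multiples of [c] the derivatives are
    [e' = w f] and [f' = eps w e], where [w] is the angular velocity of the frame. Turning [e] back
    by an angle [th] with [th' = w] cancels both tangential components. *)
Lemma exists_parallel : twice_derivable I c ->
  exists e : R -> 'M[R]_2, parallel I c e /\ ip (e 0) (e 0) = - eps.
Proof.
move=> ddc; have [e [dde eP]] := exists_unit_tangent ddc.
have dc t : I t -> derivable_within I c t by move=> /ddc[].
have de t : I t -> derivable_within I e t by move=> /dde[].
pose f s := lie (c s) (e s); pose e' := derive_within I e.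
pose w s := ip (e' s) (f s).
have ep0 : - eps != 0 by rewrite oppr_eq0.
have cw : {within I, continuous w}.
  apply: derivable_within_continuous => t It; apply: derivable_within_ip.
    by have [] := dde t It.
  by apply: derivable_within_lie; [exact: dc|exact: de].
pose th := integral_from0 w.
have dth t : I t -> is_derive_within I th t (w t).
  exact: integral_from0_is_derive_within.
exists (fun s => rot_cos eps (th s) *: e s - rot_sin eps (th s) *: f s).
have sl2e t : I t -> sl2 (e t) by move=> /eP[[]].
have ip_ce t : I t -> ip (c t) (e t) = 0 by move=> /eP[[]].
have ip_ee t : I t -> ip (e t) (e t) = - eps by move=> /eP[].
have frame t (It : I t) := ip_frame (sl2c It) (sl2e t It) (ip_cc It) (ip_ce t It)
  (ip_ee t It).
split; last first.
  have [_ ef ff] := frame 0 I0.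
  have {}ef : ip (e 0) (f 0) = 0 by [].
  have {}ff : ip (f 0) (f 0) = 1.
    by rewrite ff mulrN eps2 opprK.
  (* As [ip e e = - eps] and [ip f f = 1], the square of the turned vector is
     [- eps (C^2 - eps S^2)]. *)
  have := rot_cos2Bsin2 (th 0) eps1.
  move: (f 0) ef ff => f0 ef ff; rewrite !ipE (ipC f0) ef ff (ip_ee 0 I0).
  by move: (rot_cos _ _) (rot_sin _ _) => C S; case: eps1 => -> CS; lra.
apply: parallel_intro => // t It.
  split; last first.
    have [cf _ _] := frame t It; have {}cf : ip (c t) (f t) = 0 by [].
    move: (f t) cf => ft cf.
    by rewrite !ipE cf (ip_ce t It) !mulr0 subr0.
  apply: sl2D; first exact/sl2Z/sl2e.
  by apply/sl2N/sl2Z/sl2_lie.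
have se' : sl2 (e' t) by exact: is_derive_within_sl2 (pF It) It sl2e (de t It).
have ee' : ip (e t) (e' t) = 0.
  have := is_derive_within_ip_cst (pF It) It ip_ee (de t It) (de t It).
  by rewrite ipC -mulr2n => /eqP; rewrite mulrn_eq0 /= => /eqP.
have := frame_decomp eps0 ep0 (sl2c It) (sl2e t It) se' (ip_cc It) (ip_ce t It)
  (ip_ee t It).
rewrite ee' mul0r scale0r addr0 mulrN eps2 -/(f t) (ipC (f t)) -/(w t).
rewrite invrN invr1 mulrN mulr1 scaleNr opprK.
move: (ip _ _ / eps) => A e'E.
have [B BE] := lie_tangent eps0 (ip_cc It) (tangent_derive pF sl2c ip_cc dc It)
  (conj (sl2e t It) (ip_ce t It)) (sl2c It).
have det : is_derive_within I e t (e' t) := derivable_withinE (de t It).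
have df : is_derive_within I f t
    (lie (derive_within I c t) (e t) + lie (c t) (e' t)).
  exact: is_derive_within_lie (dc t It) det.
have cf : lie (c t) (f t) = eps *: e t.
  exact: (lie_frame (sl2c It) (sl2e t It) (ip_cc It) (ip_ce t It)).
move: df; rewrite BE e'E lieDr !lieZr lievv scaler0 add0r cf => df.
have dC := is_derive_within_comp (is_derive_rot_cos (th t) eps1) (dth t It).
have dS := is_derive_within_comp (is_derive_rot_sin eps (th t)) (dth t It).
(* [A] and [B] are the normal coefficients of [e'] and [f']; only they survive in the derivative of
   the turned vector. *)
exists (rot_cos eps (th t) * A - rot_sin eps (th t) * B).
have := is_derive_withinB (is_derive_withinZ dC det) (is_derive_withinZ dS df).
congr (is_derive_within _ _ _ _); rewrite e'E /=.
move: (f t) (w t) {cf df e'E} => ft wt.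
by apply/matrixP => i j; rewrite !mxE; ring.
Qed.

End ParallelFrame.

(** * Rolling *)

Section RolledFrame.
Context {R : realType} (I : set R).
Hypotheses (itvI : is_interval I) (I0 : I 0).
Hypothesis pF : forall t, I t -> ProperFilter (within I t^').
Variables (c e g : R -> 'M[R]_2) (m Phi : R -> R) (eps : R).
Hypotheses (eps1 : eps = 1 \/ eps = -1) (sl2c : forall t, I t -> sl2 (c t)).
Hypothesis (ip_cc : forall t, I t -> ip (c t) (c t) = eps).
Hypothesis (dc : forall t, I t -> derivable_within I c t).
Hypothesis (g_SL2 : forall t, I t -> SL2 (g t)).
Hypothesis g_ode :
  forall t, I t -> is_derive_within I g t ((m t *: c t) *m g t).
Hypothesis dPhi : forall t, I t -> is_derive_within I Phi t (m t).
Hypothesis pe : parallel I c e.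
Variable N : R -> 'M[R]_2.
Hypothesis NE : forall t, I t -> N t = Ad (invmx (g t)) (c t).

Let eps0 : eps != 0.
Proof. by case: eps1 => ->; rewrite ?oppr_eq0 oner_neq0. Qed.

Let C t := rot_cos eps (Phi t).
Let S t := rot_sin eps (Phi t).
Let f t := lie (c t) (e t).

Let gu t : I t -> invmx (g t) \in unitmx.
Proof. by move=> It; rewrite unitmx_inv unitmxE (g_SL2 It) unitr1. Qed.

(** Here [m *: c] stands for [a], so [m] is [|a|]. For [X = C e + S f], the tangential part of [X']
    is [m (eps S e + C f)], while [lie X a] is its exact opposite; what remains of [X' + lie X a] is
    a multiple of [c]. *)
Lemma parallel_rolled :
  parallel I N (fun t => Ad (invmx (g t)) (C t *: e t + S t *: f t)).
Proof.
have pf : parallel I c f := parallel_lie pF eps0 sl2c ip_cc dc pe.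
apply: parallel_intro => // t It; have [[se ce] _ _] := pe It;
  have [[sf cf] _ _] := pf t It.
  split; first by apply: (sl2_Ad (gu It)); apply: sl2D; exact: sl2Z.
  rewrite NE// (ip_Ad (gu It)) !ipDr !ipZr ce.
  by rewrite [ip (c t) (f t)]cf !mulr0 addr0.
have [x ex] := parallel_is_derive pe It; have [y fy] := parallel_is_derive pf It.
have dC := is_derive_within_comp (is_derive_rot_cos (Phi t) eps1) (dPhi It).
have dS := is_derive_within_comp (is_derive_rot_sin eps (Phi t)) (dPhi It).
have lfc : lie (f t) (c t) = - (eps *: e t).
  by rewrite lieC (lie_frame (sl2c It) se (ip_cc It) ce).
have lec : lie (e t) (c t) = - f t by rewrite lieC.
exists (C t * x + S t * y); rewrite NE// -AdZ.
have := is_derive_within_Ad_inv (fun s Is => sl2Z (m s) (sl2c Is)) g_SL2 It (g_ode It)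
  (is_derive_withinD (is_derive_withinZ dC ex) (is_derive_withinZ dS fy)).
congr (is_derive_within _ _ _ (Ad _ _)).
rewrite lieZr lieDl !lieZl lfc lec /= -/(C t) -/(S t).
move: (f t) {lfc lec sf cf fy} => ft.
by apply/matrixP => i j; rewrite !mxE; ring.
Qed.

Lemma is_derive_within_rolled t : I t ->
  is_derive_within I N t (Ad (invmx (g t)) (derive_within I c t)).
Proof.
move=> It; have := is_derive_within_Ad_inv (fun s Is => sl2Z (m s) (sl2c Is)) g_SL2
  It (g_ode It) (dc It).
rewrite lieZr lievv scaler0 addr0; apply: eq_is_derive_within => //.
by move=> s /[!inE] Is; rewrite NE.
Qed.

(** The vector [x] is expanded in the frame [(N, E, lie N E)] at time [t], where [E] is the rolled
    field of [parallel_rolled]. The inverse transport along [N] carries this frame to [(c, e, f)] at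
    time 0; the rotation then mixes [e] and [f] exactly as [Ad (g t)] does at time [t]. *)
Lemma Ad_transport (a0 : 'M[R]_2) t x : g 0 = 1%:M -> Phi 0 = 0 ->
  ip (e 0) (e 0) = - eps -> unitize a0 = c 0 -> I t -> sl2 x ->
  Ad (g t) x = transport I c t (pseudo_rotation a0 (Phi t)
    ('pinv_(fun=> 0) sl2 (transport I N t) x)).
Proof.
move=> g0 Phi0 ee a0E It sx.
have dN s : I s -> derivable_within I N s.
  by move=> Is; exact: is_derive_within_derivable (is_derive_within_rolled Is).
have sl2N s : I s -> sl2 (N s) by move=> Is; rewrite NE//; exact/(sl2_Ad (gu Is))/sl2c.
have ip_NN s : I s -> ip (N s) (N s) = eps.
  by move=> Is; rewrite NE// (ip_Ad (gu Is)) ip_cc.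
have ep0 : - eps != 0 by rewrite oppr_eq0.
have pE := parallel_rolled; set E := (X in parallel I N X) in pE.
have Ad1 (y : 'M[R]_2) : Ad (invmx (g 0)) y = y.
  by rewrite g0 /Ad !invmx1 mul1mx mulmx1.
(* At time 0 the two frames coincide, because [g 0] is the identity and the angle [Phi 0] is 0. *)
have E0 : E 0 = e 0.
  by rewrite /E Ad1 /C /S Phi0 rot_cos0 rot_sin0 scale1r scale0r addr0.
have N0 : N 0 = c 0 by rewrite NE.
have [[se ce] _ _] := pe It; have [[sE NEt] _ _] := pE t It.
have EE s : I s -> ip (E s) (E s) = - eps.
  by move=> Is; rewrite (parallel_ip itvI I0 pE pE Is) E0.
have gE : Ad (g t) (E t) = C t *: e t + S t *: f t.
  by rewrite /E AdVK// unitmxE (g_SL2 It) unitr1.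
have gN : Ad (g t) (N t) = c t.
  by rewrite NE// AdVK// unitmxE (g_SL2 It) unitr1.
have gF : Ad (g t) (lie (N t) (E t)) = C t *: f t + S t *: (eps *: e t).
  rewrite Ad_lie ?gE ?gN; last by rewrite unitmxE (g_SL2 It) unitr1.
  by rewrite lieDr !lieZr (lie_frame (sl2c It) se (ip_cc It) ce).
have [al [be [ga ->]]] : exists al be ga : R,
    x = al *: N t + be *: E t + ga *: lie (N t) (E t).
  exists (ip (N t) x / eps), (ip (E t) x / - eps),
    (- (ip (lie (N t) (E t)) x / (eps * - eps))); rewrite scaleNr.
  exact: (frame_decomp eps0 ep0 (sl2N t It) sE sx (ip_NN t It) NEt (EE t It)).
have -> := pinv_transport_comb itvI I0 pF eps0 sl2N ip_NN dN ep0 pE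
  (EE 0 I0) al be ga It.
rewrite /= N0 E0.
have [[se0 ce0] _ _] := pe I0.
have -> : pseudo_rotation a0 (Phi t)
    (al *: c 0 + be *: e 0 + ga *: lie (c 0) (e 0)) =
    al *: c 0 + (be * C t + ga * (eps * S t)) *: e 0 +
    (be * S t + ga * C t) *: lie (c 0) (e 0).
  rewrite -a0E; apply: pseudo_rotation_comb; rewrite ?a0E//; first exact: sl2c.
  exact: ip_cc.
rewrite (transport_comb itvI I0 pF eps0 sl2c ip_cc dc ep0 pe ee _ _ _ It).
rewrite !AdD !AdZ gN gE gF -[lie (c t) (e t)]/(f t) /=.
move: (f t) (C t) (S t) {gE gF} => ft Ct St.
by apply/matrixP => i j; rewrite !mxE; ring.
Qed.

End RolledFrame.

(** * Geodesic curvature as an inner product with the normal *)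

Section GeodesicCurvature.
Context {R : realType} (I : set R).
Hypothesis pF : forall t, I t -> ProperFilter (within I t^').

Variables (c : R -> 'M[R]_2) (eps : R).
Hypotheses (eps0 : eps != 0) (sl2c : forall t, I t -> sl2 (c t)).
Hypothesis (ip_cc : forall t, I t -> ip (c t) (c t) = eps).
Hypothesis (dc : forall t, I t -> derivable_within I c t).
Let tau := arc_derive I c c.

Lemma tangent_arc_derive s : I s -> tangent (c s) (tau s).
Proof.
move=> Is; have [sc cc'] := tangent_derive pF sl2c ip_cc dc Is.
by split; [exact: sl2Z|rewrite /tau ipZr cc' mulr0].
Qed.

Lemma ip_arc_derive_neq0 t : pnorm (derive_within I c t) != 0 ->
  ip (tau t) (tau t) != 0.
Proof.
by rewrite pnorm_neq0 => h; rewrite ip_unitize mulf_neq0// invr_eq0 normr_eq0.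
Qed.

Lemma ip_arc_normal_neq0 t : I t -> pnorm (derive_within I c t) != 0 ->
  ip (lie (c t) (tau t)) (lie (c t) (tau t)) != 0.
Proof.
move=> It c't0; have [stau ctau] := tangent_arc_derive It.
have [_ _ ->] := ip_frame (sl2c It) stau (ip_cc It) ctau erefl.
by rewrite oppr_eq0 mulf_neq0// ip_arc_derive_neq0.
Qed.

(** Pairing with [f] kills the components along [c] and [tau], which isolates the curvature and
    makes it unique. Dividing by [ip f f] takes care of the sign of the normal on either
    pseudo-sphere. *)
Lemma geodesic_curvatureE t (T : 'M[R]_2) :
  let f := lie (c t) (tau t) in I t -> pnorm (derive_within I c t) != 0 ->
  is_derive_within I tau t T ->
  geodesic_curvature I c t =
    ip f ((pnorm (derive_within I c t))^-1 *: T) / ip f f.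
Proof.
move=> f It c't0 dtau.
have [stau ctau] := tangent_arc_derive It.
have tau0 := ip_arc_derive_neq0 c't0.
have [cf tauf _] := ip_frame (sl2c It) stau (ip_cc It) ctau erefl.
have {}cf : ip (c t) f = 0 := cf; have {}tauf : ip (tau t) f = 0 := tauf.
have f0 : ip f f != 0 := ip_arc_normal_neq0 It c't0.
rewrite /geodesic_curvature -/tau /arc_derive (derive_within_unique (pF It) dtau).
set c'' := _^-1 *: T; set K := [set k | _].
have sc'' : sl2 c''.
  apply: sl2Z; apply: is_derive_within_sl2 (pF It) It _ dtau => s Is.
  by have [] := tangent_arc_derive Is.
have KE k : K k -> k = ip f c'' / ip f f.
  move=> [x [y]]; rewrite -/(tau t) -/f => ->.
  clearbody f; move: (tau t) tauf => u uf; rewrite !ipDr !ipZr.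
  by rewrite (ipC f (c t)) (ipC f u) cf uf; field.
(* The witness is the coefficient from [frame_decomp]; by [ip_frame] it agrees with the quotient by
   [ip f f]. *)
apply: KE; apply: (@getI _ K (- (ip f c'' / (eps * ip (tau t) (tau t))))).
exists (ip (c t) c'' / eps), (ip (tau t) c'' / ip (tau t) (tau t)).
rewrite scaleNr.
exact: (frame_decomp eps0 tau0 (sl2c It) stau sc'' (ip_cc It) ctau erefl).
Qed.

End GeodesicCurvature.

Section Rolling.
Context {R : realType} (I : set R).
Hypothesis pF : forall t, I t -> ProperFilter (within I t^').
Variables (c g N : R -> 'M[R]_2) (m : R -> R) (eps : R).
Hypotheses (eps0 : eps != 0) (sl2c : forall t, I t -> sl2 (c t)).
Hypothesis (ip_cc : forall t, I t -> ip (c t) (c t) = eps).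
Hypothesis ddc : twice_derivable I c.
Hypothesis (g_SL2 : forall t, I t -> SL2 (g t)).
Hypothesis g_ode :
  forall t, I t -> is_derive_within I g t ((m t *: c t) *m g t).
Hypothesis NE : forall t, I t -> N t = Ad (invmx (g t)) (c t).

(** The tangent of [N] is the image of [tau] under [Ad (invmx g)], so its derivative is the image of
    [T + lie tau (m c) = T - m f], with [f = lie c tau]. Dividing by the common speed and pairing
    with the normal shifts the curvature by [- m / |c'|]. *)
Lemma geodesic_curvature_rolled t :
  (forall s, I s -> pnorm (derive_within I c s) != 0) -> I t ->
  geodesic_curvature I N t =
    geodesic_curvature I c t - m t / pnorm (derive_within I c t).
Proof.
move=> c'0 It.
have dc s : I s -> derivable_within I c s by move=> /ddc[].
have gu s : I s -> invmx (g s) \in unitmx.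
  by move=> Is; rewrite unitmx_inv unitmxE (g_SL2 Is) unitr1.
have isdN s : I s ->
    is_derive_within I N s (Ad (invmx (g s)) (derive_within I c s)).
  by move=> Is; exact: (is_derive_within_rolled sl2c dc g_SL2 g_ode NE Is).
have N'E s : I s -> derive_within I N s = Ad (invmx (g s)) (derive_within I c s).
  by move=> Is; exact: derive_within_unique (pF Is) (isdN s Is).
have pN' s : I s -> pnorm (derive_within I N s) = pnorm (derive_within I c s).
  by move=> Is; rewrite N'E// /pnorm (ip_Ad (gu s Is)).
pose tau := arc_derive I c c.
have dtau : derivable_within I tau t.
  have [_ ddct] := ddc It; have := c'0 t It; rewrite pnorm_neq0 => c't0.
  (* By definition, [tau] is the [unitize] of the velocity of [c]. *)
  exact: is_derive_within_derivable (is_derive_within_unitize c't0 (derivable_withinE ddct)).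
have := derivable_withinE dtau; set T := derive_within I tau t => dT.
have tauNE s : I s -> arc_derive I N N s = Ad (invmx (g s)) (tau s).
  by move=> Is; rewrite /arc_derive pN'// N'E// -AdZ.
have dTN : is_derive_within I (arc_derive I N N) t
    (Ad (invmx (g t)) (T + lie (tau t) (m t *: c t))).
  have := is_derive_within_Ad_inv (fun s Is => sl2Z (m s) (sl2c Is)) g_SL2 It
    (g_ode It) dT.
  by apply: eq_is_derive_within => // s /[!inE] Is; rewrite tauNE.
have fN : lie (N t) (arc_derive I N N t) = Ad (invmx (g t)) (lie (c t) (tau t)).
  by rewrite NE// tauNE// -(Ad_lie (gu t It)).
rewrite (geodesic_curvatureE pF eps0 sl2c ip_cc dc It (c'0 t It) dT).
have dN s : I s -> derivable_within I N s.
  by move=> /isdN; exact: is_derive_within_derivable.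
have ip_NN s : I s -> ip (N s) (N s) = eps.
  by move=> Is; rewrite NE// (ip_Ad (gu s Is)) ip_cc.
have sl2N s : I s -> sl2 (N s).
  by move=> Is; rewrite NE//; exact/(sl2_Ad (gu s Is))/sl2c.
have N't0 : pnorm (derive_within I N t) != 0 by rewrite (pN' t It); exact: c'0.
rewrite (geodesic_curvatureE pF eps0 sl2N ip_NN dN It N't0 dTN).
have f0 := ip_arc_normal_neq0 pF eps0 sl2c ip_cc dc It (c'0 t It).
rewrite fN pN'// -AdZ !(ip_Ad (gu t It)) lieZr (lieC (tau t)).
have {}f0 : ip (lie (c t) (tau t)) (lie (c t) (tau t)) != 0 := f0.
move: (lie _ _) f0 => f f0; have q0 := c'0 t It.
by rewrite scalerN !(ipZr, ipDr, ipNr); field; rewrite q0 f0.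
Qed.

End Rolling.

Theorem theorem2 (R : realType) (I : set R) (a g : R -> 'M[R]_2)
    (I_itv : is_interval I) (I0 : I 0) (I_nontriv : exists2 t, I t & t != 0)
    (a_sl2 : forall t, I t -> sl2 (a t))
    (a_smooth : smooth_within I a)
    (a_neq0 : forall t, I t -> pnorm (a t) != 0)
    (g_SL2 : forall t, I t -> SL2 (g t))
    (g_ode : forall t, I t -> is_derive_within I g t (a t *m g t))
    (g0 : g 0 = 1%:M) :
  let A : R -> 'M[R]_2 := fun t => invmx (g t) *m a t *m g t in
  let n : R -> 'M[R]_2 := fun t => unitize (a t) in
  let N : R -> 'M[R]_2 := fun t => unitize (A t) in
  let ndot := derive_within I n in
  let Ndot := derive_within I N in
  let Phi := integral_from0 (fun t => pnorm (a t)) in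
  [/\ forall t, I t -> Ad (g t) (N t) = n t /\ Ad (g t) (Ndot t) = ndot t,
      (forall t, I t -> pnorm (ndot t) != 0) ->
      forall t, I t ->
        geodesic_curvature I N t =
          geodesic_curvature I n t - pnorm (a t) / pnorm (ndot t) &
      forall t, I t -> forall x, sl2 x ->
        Ad (g t) x =
          (transport I n t \o pseudo_rotation (a 0) (Phi t)
             \o 'pinv_(fun=> 0) sl2 (transport I N t)) x].
Proof.
move=> A n N ndot Ndot Phi.
have pF t : I t -> ProperFilter (within I t^').
  move=> It; have [r Ir r0] := I_nontriv.
  (* A second point of [I] is 0 when [t] is nonzero, and [r] when [t = 0]. *)
  have [t0|t0] := eqVneq t 0; last by apply: (within_dnbhs_proper I_itv I0 It); rewrite eq_sym.
  by apply: (within_dnbhs_proper I_itv Ir It); rewrite t0.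
have gu t : I t -> g t \in unitmx by move=> It; rewrite unitmxE (g_SL2 t It) unitr1.
have q0 t : I t -> ip (a t) (a t) != 0 by move=> It; rewrite -pnorm_neq0 a_neq0.
have dda : twice_derivable I a.
  by move=> t It; split; [exact: (a_smooth 0)|exact: (a_smooth 1)].
have da t : I t -> derivable_within I a t by move=> /dda[].
have ddn : twice_derivable I n by exact: twice_derivable_unitize.
have dn t : I t -> derivable_within I n t by move=> /ddn[].
(* The sign of [ip (a t) (a t)] is constant on [I], so its value at 0 decides the pseudo-sphere once
   and for all. *)
have [eps eps1 ip_nn] : exists2 eps : R, eps = 1 \/ eps = -1 &
    forall t, I t -> ip (n t) (n t) = eps.
  have cq : {within I, continuous (fun t => ip (a t) (a t))}.
    apply: derivable_within_continuous => t It.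
    by apply: derivable_within_ip; exact: da.
  have [aN|aP|/eqP] := ltgtP (ip (a 0) (a 0)) 0; last by rewrite (negbTE (q0 0 I0)).
    exists (-1); first by right.
    move=> t It; rewrite ip_unitize ltr0_norm ?invrN ?mulrN ?divff ?q0//.
    rewrite lt_neqAle q0//= leNgt; apply/negP => at0.
    have := continuous_within_gt0 I_itv cq q0 It I0 at0.
    by rewrite ltNge ltW.
  exists 1; first by left.
  move=> t It; rewrite ip_unitize gtr0_norm ?divff ?q0//.
  exact: (continuous_within_gt0 I_itv cq q0 I0 It aP).
have eps0 : eps != 0 by case: eps1 => ->; rewrite ?oppr_eq0 oner_neq0.
have sl2n t : I t -> sl2 (n t) by move=> It; exact/sl2_unitize/a_sl2.
(* [Ad] preserves [ip], so [A] and [a] have the same norm, and normalization commutes with [Ad]. *)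
have NE t : I t -> N t = Ad (invmx (g t)) (n t).
  move=> It; have AE : A t = Ad (invmx (g t)) (a t) by rewrite /Ad invmxK.
  rewrite /N /n /unitize AE AdZ /pnorm ip_Ad// unitmx_inv; exact: gu.
(* Writing [a] as [|a| n] puts the equation for [g] in the form of the rolling lemmas, with [n] for
   [c] and [|a|] for [m]. *)
have aE t : I t -> a t = pnorm (a t) *: n t.
  by move=> It; rewrite /n /unitize scalerA divff ?scale1r// a_neq0.
have g_ode' t : I t -> is_derive_within I g t ((pnorm (a t) *: n t) *m g t).
  by move=> It; rewrite -aE//; exact: g_ode.
split.
- move=> t It; split; first by rewrite NE// AdVK// gu.
  rewrite /Ndot (derive_within_unique (pF t It)
    (is_derive_within_rolled sl2n dn g_SL2 g_ode' NE It)).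
  by rewrite AdVK// gu.
- move=> n'0 t It.
  exact: (geodesic_curvature_rolled pF eps0 sl2n ip_nn ddn g_SL2 g_ode' NE n'0 It).
- move=> t It x sx /=.
  have [e [pe ee]] := exists_parallel I_itv I0 pF eps1 sl2n ip_nn ddn.
  have cm : {within I, continuous (fun s => pnorm (a s))}.
    apply: derivable_within_continuous => s Is.
    apply: is_derive_within_derivable.
    exact: (is_derive_within_pnorm (q0 s Is) (derivable_withinE (da s Is))).
  have dPhi s (Is : I s) := integral_from0_is_derive_within I_itv I0 cm Is.
  have Phi0 : Phi 0 = 0 by rewrite /Phi /integral_from0 lexx set_itv1 Rintegral_set1.
  exact: (Ad_transport I_itv I0 pF eps1 sl2n ip_nn dn g_SL2 g_ode' dPhi pe NE
    g0 Phi0 ee erefl It sx).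
Qed.
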